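(* Let $P(\alpha,\beta)=\sum_{i=0}^k \alpha^i\beta^{k-i}B_i$, $B_i\in\mathbb{C}^{n\times n}$, be a regular homogeneous matrix polynomial of grade $k$, and let $(\alpha_0,\beta_0)\neq(0,0)$ be a simple eigenvalue of $P(\alpha,\beta)$. Let $\omega_0,\dots,\omega_k\ge 0$ be weights, the same for both condition numbers below, with $\sum_{i=0}^k |\alpha_0|^{i}|\beta_0|^{k-i}\omega_i\neq 0$. Then the Dedieu–Tisseur condition number $\kappa_h$ and the Stewart–Sun condition number $\kappa_\theta$ satisfy $$\kappa_h((\alpha_0,\beta_0),P)=\frac{\left(\sum_{i=0}^k|\alpha_0|^{2i}|\beta_0|^{2(k-i)}\omega_i^2\right)^{1/2}}{\sum_{i=0}^k|\alpha_0|^{i}|\beta_0|^{k-i}\omega_i}\ \kappa_\theta((\alpha_0,\beta_0),P).$$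
   Context: $P(\alpha,\beta)$ is regular if $\det P(\alpha,\beta)\not\equiv 0$. An eigenvalue of $P(\alpha,\beta)$ is a line through the origin in $\mathbb{C}^2$ consisting of solutions of $\det P(\alpha,\beta)=0$; it is denoted $(\alpha_0,\beta_0)$, where $(\alpha_0,\beta_0)\neq(0,0)$ also denotes a chosen representative. It is simple if $\det P(\alpha,\beta)$ has this line as a zero of multiplicity one. Nonzero $x,y\in\mathbb{C}^n$ are right and left eigenvectors associated with $(\alpha_0,\beta_0)$ if $P(\alpha_0,\beta_0)x=0$ and $y^*P(\alpha_0,\beta_0)=0$. $\|\cdot\|_2$ is the Euclidean norm on vectors and the spectral norm on matrices, and $D_a\equiv\partial/\partial a$. Dedieu–Tisseur condition number: given (independently of the representative) by $$\kappa_h((\alpha_0,\beta_0),P)=\left(\sum_{i=0}^k|\alpha_0|^{2i}|\beta_0|^{2(k-i)}\omega_i^2\right)^{1/2}\frac{\|y\|_2\|x\|_2}{|y^*(\overline{\beta_0}D_\alpha P(\alpha_0,\beta_0)-\overline{\alpha_0}D_\beta P(\alpha_0,\beta_0))x|},$$ where $x,y$ are right and left eigenvectors associated with $(\alpha_0,\beta_0)$. Chordal distance: for lines $\langle x\rangle,\langle y\rangle$ through the origin in $\mathbb{C}^2$ spanned by nonzero vectors $x,y$, $\theta(\langle x\rangle,\langle y\rangle)=\arccos\frac{|y^*x|}{\|x\|_2\|y\|_2}\in[0,\pi/2]$ and $\chi(\langle x\rangle,\langle y\rangle)=\sin\theta(\langle x\rangle,\langle y\rangle)$. Stewart–Sun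 condition number: $$\kappa_\theta((\alpha_0,\beta_0),P)=\lim_{\epsilon\to0}\sup\Big\{\frac{\chi((\alpha_0,\beta_0),(\alpha_0+\Delta\alpha_0,\beta_0+\Delta\beta_0))}{\epsilon}: [P+\Delta P](\alpha_0+\Delta\alpha_0,\beta_0+\Delta\beta_0)(x+\Delta x)=0,\ \|\Delta B_i\|_2\le\epsilon\,\omega_i,\ i=0,\dots,k\Big\},$$ where $\Delta P(\alpha,\beta)=\sum_{i=0}^k\alpha^i\beta^{k-i}\Delta B_i$, $x$ is a right eigenvector of $P$ for $(\alpha_0,\beta_0)$, $x+\Delta x$ is an associated right eigenvector of $P+\Delta P$, and $(\alpha_0+\Delta\alpha_0,\beta_0+\Delta\beta_0)$ is the unique simple eigenvalue of $P+\Delta P$ that approaches $(\alpha_0,\beta_0)$ as $\Delta P\to0$. *)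

(* Defs.v *)
From mathcomp Require Import all_boot all_order all_algebra.
From mathcomp Require Import sesquilinear spectral polyXY complex.
From mathcomp Require Import all_classical all_reals all_analysis.

Set Implicit Arguments.
Unset Strict Implicit.
Unset Printing Implicit Defensive.

Import Order.TTheory GRing.Theory Num.Theory.
Import numFieldNormedType.Exports.

Local Open Scope classical_set_scope.
Local Open Scope sesquilinear_scope.
Local Open Scope ring_scope.

(* The modulus as an element of R; the norm of numDomainType on R[i] is
   itself R[i]-valued. *)
Definition cabs (R : realType) (z : R[i]) : R := ComplexField.Normc.normc z.

Definition norm2 (R : realType) (n : nat) (x : 'cV[R[i]]_n) : R :=
  Num.sqrt (\sum_(i < n) cabs (x i 0) ^+ 2).

Definition spectral_norm (R : realType) (n : nat) (A : 'M[R[i]]_n) : R :=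
  sup [set norm2 (A *m x) | x in [set x : 'cV[R[i]]_n | norm2 x <= 1]].

(* A grade-k homogeneous matrix polynomial is given by its coefficients
   B_0, ..., B_k.  The grade is part of the data: leading or trailing
   coefficients may vanish. *)
Definition coeffs (R : realType) (n k : nat) := 'I_k.+1 -> 'M[R[i]]_n.

(* Bivariate polynomials are polynomials in alpha = 'X with coefficients
   polynomials in beta = 'Y, so that evaluation is p.[alpha, beta]. *)
Definition hmxpoly (R : realType) (n k : nat) (B : coeffs R n k) :
    'M[{poly {poly R[i]}}]_n :=
  \sum_(i < k.+1) ('X^i * 'Y ^+ (k - i)) *: map_mx (fun c => c%:P%:P) (B i).

Definition evalmx (R : realType) (n : nat) (P : 'M[{poly {poly R[i]}}]_n)
    (l : R[i] * R[i]) : 'M[R[i]]_n :=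
  map_mx (fun p : {poly {poly R[i]}} => p.[l.1, l.2]) P.

Definition dalpha (R : realType) (n : nat) (P : 'M[{poly {poly R[i]}}]_n) :
    'M[{poly {poly R[i]}}]_n :=
  map_mx (fun p : {poly {poly R[i]}} => p^`()) P.

Definition dbeta (R : realType) (n : nat) (P : 'M[{poly {poly R[i]}}]_n) :
    'M[{poly {poly R[i]}}]_n :=
  map_mx (map_poly (fun q : {poly R[i]} => q^`())) P.

Definition regular (R : realType) (n k : nat) (B : coeffs R n k) : Prop :=
  \det (hmxpoly B) != 0.

(* Lines through the origin of C^2 are handled through nonzero
   representatives l = (alpha, beta). *)
Definition eigenvalue_line (R : realType) (n k : nat) (B : coeffs R n k)
    (l : R[i] * R[i]) : Prop :=
  l != (0, 0) /\ (\det (hmxpoly B)).[l.1, l.2] = 0.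

(* The linear form beta_0 alpha - alpha_0 beta, whose zero set is the line. *)
Definition line_form (R : realType) (l : R[i] * R[i]) : {poly {poly R[i]}} :=
  l.2%:P%:P * 'X - l.1%:P%:P * 'Y.

(* Divisibility is written out in C[beta][alpha]: the library's %| on
   {poly {poly C}} is pseudo-divisibility, i.e. divisibility over C(beta). *)
Definition line_multiplicity (R : realType) (p : {poly {poly R[i]}})
    (l : R[i] * R[i]) (m : nat) : Prop :=
  (exists q, p = line_form l ^+ m * q) /\
  ~ (exists q, p = line_form l ^+ m.+1 * q).

Definition simple_eigenvalue (R : realType) (n k : nat) (B : coeffs R n k)
    (l : R[i] * R[i]) : Prop :=
  eigenvalue_line B l /\ line_multiplicity (\det (hmxpoly B)) l 1.

Definition right_eigenvector (R : realType) (n k : nat) (B : coeffs R n k)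
    (l : R[i] * R[i]) (x : 'cV[R[i]]_n) : Prop :=
  x != 0 /\ evalmx (hmxpoly B) l *m x = 0.

Definition left_eigenvector (R : realType) (n k : nat) (B : coeffs R n k)
    (l : R[i] * R[i]) (y : 'cV[R[i]]_n) : Prop :=
  y != 0 /\ y ^t* *m evalmx (hmxpoly B) l = 0.

Definition col2 (R : realType) (l : R[i] * R[i]) : 'cV[R[i]]_2 :=
  \col_(i < 2) (if i == 0 then l.1 else l.2).

Definition line_angle (R : realType) (l m : R[i] * R[i]) : R :=
  acos (cabs (((col2 m) ^t* *m col2 l) 0 0) /
        (norm2 (col2 l) * norm2 (col2 m))).

Definition chordal (R : realType) (l m : R[i] * R[i]) : R :=
  sin (line_angle l m).

(* The eigenvectors x, y are arguments; the value does not depend on their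
   choice when l is simple, and they are quantified universally in use. *)
Definition kappa_h (R : realType) (n k : nat) (w : 'I_k.+1 -> R)
    (B : coeffs R n k) (l : R[i] * R[i]) (x y : 'cV[R[i]]_n) : R :=
  let P := hmxpoly B in
  Num.sqrt (\sum_(i < k.+1)
    cabs l.1 ^+ (2 * i) * cabs l.2 ^+ (2 * (k - i)) * w i ^+ 2) *
  (norm2 y * norm2 x /
    cabs ((y ^t* *m (l.2^* *: evalmx (dalpha P) l
                     - l.1^* *: evalmx (dbeta P) l) *m x) 0 0)).

Definition perturb (R : realType) (n k : nat) (B dB : coeffs R n k) :
    coeffs R n k := fun i => B i + dB i.

(* mu selects, for every small perturbation dB, (a representative of) a simple
   eigenvalue of the perturbed polynomial that approaches l as dB tends to 0.
   The values of mu at large dB are unconstrained and play no role in the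
   limit below. *)
Definition eigenvalue_branch (R : realType) (n k : nat) (B : coeffs R n k)
    (l : R[i] * R[i]) (mu : coeffs R n k -> R[i] * R[i]) : Prop :=
  (\forall d \near (0 : R)^'+, forall dB : coeffs R n k,
     (forall i, spectral_norm (dB i) <= d) ->
     simple_eigenvalue (perturb B dB) (mu dB)) /\
  (forall e : R, 0 < e -> \forall d \near (0 : R)^'+, forall dB : coeffs R n k,
     (forall i, spectral_norm (dB i) <= d) -> chordal l (mu dB) < e).

(* When l is a simple eigenvalue of B such a mu exists, and any two of them
   give the same lines for all sufficiently small dB. *)
Definition perturbed_eigenvalue (R : realType) (n k : nat) (B : coeffs R n k)
    (l : R[i] * R[i]) : coeffs R n k -> R[i] * R[i] :=
  xget (fun=> l) [set mu | eigenvalue_branch B l mu].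

Definition theta_quotients (R : realType) (n k : nat) (w : 'I_k.+1 -> R)
    (B : coeffs R n k) (l : R[i] * R[i]) (e : R) : set R :=
  [set r | exists (dB : coeffs R n k) (da db : R[i]) (x dx : 'cV[R[i]]_n),
     let l' := (l.1 + da, l.2 + db) in
     [/\ forall i, spectral_norm (dB i) <= e * w i,
         l' = perturbed_eigenvalue B l dB,
         right_eigenvector B l x,
         right_eigenvector (perturb B dB) l' (x + dx)
       & r = chordal l l' / e]].

Definition kappa_theta (R : realType) (n k : nat) (w : 'I_k.+1 -> R)
    (B : coeffs R n k) (l : R[i] * R[i]) : R :=
  lim (sup (theta_quotients w B l e) @[e --> (0 : R)^'+]).

(* Main.v *)
Require Import Defs.
From mathcomp Require Import all_boot all_order all_algebra.
From mathcomp Require Import perm sesquilinear spectral polyXY complex.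
From mathcomp Require Import zify ring lra.
From mathcomp Require Import all_classical all_reals all_analysis.
Import Order.TTheory GRing.Theory Num.Theory.
Import numFieldNormedType.Exports.
Local Open Scope classical_set_scope.
Local Open Scope sesquilinear_scope.
Local Open Scope ring_scope.

Set Implicit Arguments.
Unset Strict Implicit.
Unset Printing Implicit Defensive.

(* Let m = (conj beta0, - conj alpha0) be the normal direction, of the same
   length as l = (alpha0, beta0), and restrict everything to the affine line
   l + t m, where P becomes a matrix polynomial Q0 + t Q1 + O(t^2) and the line
   form becomes a nonzero multiple of t.  Simplicity of l means that t = 0 is a
   simple root of det Q; since t^(n - rank Q0) divides det Q, the kernel of Q0 is
   one-dimensional, and expanding Q adj(Q) = det Q at t = 0 gives y^* Q1 x <> 0.
   A simple root persists under perturbation, which gives the branch l + t m.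
   If (Q0 + D) z = 0 with D small, then z, suitably scaled, is O(D)-close to x,
   because (Q0 + y x^* )(x - z) = D z and Q0 + y x^* is invertible; multiplying by
   y^* yields t y^* Q1 x + y^* dP(l) x = O((|t| + eps)^2).
   The chordal distance from l to l + t m is |t| / sqrt (1 + |t|^2), so kappa_theta
   is the maximum of |y^* dP(l) x| / |y^* Q1 x| over unit-size perturbations,
   attained at rank-one multiples of y x^* with phases aligned to
   alpha0^i beta0^(k-i). *)

(** * Homogenization of univariate polynomials in two ring elements s, t *)

Section Homogenization.
Variables (F A : comNzRingType) (phi : {rmorphism F -> A}) (s t : A).
Implicit Types (p q : {poly F}) (P Q : A) (d e : nat).

(** For [p] of degree at most [d] this is s^d p(t/s), written without division. *)
Definition homogenize d p : A :=
  \sum_(j < d.+1) phi p`_j * (s ^+ (d - j) * t ^+ j).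

Lemma homogenizeD d p q :
  homogenize d (p + q) = homogenize d p + homogenize d q.
Proof.
rewrite /homogenize -big_split /=; apply: eq_bigr => j _.
by rewrite coefD rmorphD mulrDl.
Qed.

Lemma homogenizeZ d c p : homogenize d (c *: p) = phi c * homogenize d p.
Proof.
rewrite /homogenize mulr_sumr; apply: eq_bigr => j _.
by rewrite coefZ rmorphM -mulrA.
Qed.

Lemma homogenizeXn d i p :
  homogenize (i + d) ('X^i * p) = t ^+ i * homogenize d p.
Proof.
elim: i => [|i IH]; first by rewrite expr0 !mul1r.
rewrite !exprS -!mulrA -IH; set q := 'X^i * p.
rewrite /homogenize addSn big_ord_recl coefXM rmorph0 mul0r add0r mulr_sumr.
apply: eq_bigr => j _; rewrite coefXM /= subSS exprS; ring.
Qed.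

Lemma homogenize_widen d i p : (size p <= d.+1)%N ->
  homogenize (i + d) p = s ^+ i * homogenize d p.
Proof.
move=> sp; elim: i => [|i IH]; first by rewrite expr0 mul1r.
rewrite exprS -mulrA -IH addSn /homogenize big_ord_recr /=.
rewrite nth_default ?rmorph0 ?mul0r ?addr0; last first.
  by apply: leq_trans sp _; rewrite -addSn addnC -addSnnS leq_addr.
rewrite mulr_sumr; apply: eq_bigr => j _.
rewrite subSn; last by rewrite -ltnS ltn_ord.
by rewrite exprS; ring.
Qed.

Lemma homogenizeM d e p q : (size p <= d.+1)%N -> (size q <= e.+1)%N ->
  homogenize (d + e) (p * q) = homogenize d p * homogenize e q.
Proof.
move=> sp sq.
have hsum (I : Type) (r : seq I) (G : I -> {poly F}) D :
    homogenize D (\sum_(i <- r) G i) = \sum_(i <- r) homogenize D (G i).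
  elim: r => [|x r IH]; last by rewrite !big_cons homogenizeD IH.
  rewrite !big_nil /homogenize big1 // => j _.
  by rewrite coef0 rmorph0 mul0r.
have -> : p = \sum_(i < d.+1) p`_i *: 'X^i.
  by rewrite -[LHS](take_poly_id sp) /take_poly poly_def.
rewrite mulr_suml !hsum mulr_suml; apply: eq_bigr => i _.
rewrite -scalerAl !homogenizeZ -mulrA; congr (_ * _).
have le_id : (i <= d)%N by rewrite -ltnS ltn_ord.
move: (i : nat) le_id => {}i le_id.
rewrite -(subnKC le_id) -addnA homogenizeXn homogenize_widen //.
rewrite -['X^i]mulr1 homogenizeXn -[X in homogenize X 1]addn0.
rewrite homogenize_widen ?size_poly1 // -!mulrA; congr (_ * (_ * _)).
by rewrite /homogenize big_ord1 coef1 rmorph1 !expr0 !mul1r.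
Qed.

(** The size bound travels with the identity, since multiplicativity rests on the nominal degree
    bounds of both factors. *)
Definition homog d p P := (size p <= d.+1)%N /\ P = homogenize d p.

Lemma homogD d p q P Q : homog d p P -> homog d q Q -> homog d (p + q) (P + Q).
Proof.
move=> [sp ->] [sq ->]; split; last by rewrite homogenizeD.
by rewrite (leq_trans (size_polyD _ _)) // geq_max sp.
Qed.

Lemma homogZ d c p P : homog d p P -> homog d (c *: p) (phi c * P).
Proof.
move=> [sp ->]; split; last by rewrite homogenizeZ.
exact: leq_trans (size_scale_leq _ _) sp.
Qed.

Lemma homogM d e p q P Q :
  homog d p P -> homog e q Q -> homog (d + e) (p * q) (P * Q).
Proof.
move=> [sp ->] [sq ->]; split; last by rewrite homogenizeM.
rewrite (leq_trans (size_polyMleq _ _)) // -ltnS.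
by case: (size p) sp => [|a] sp; case: (size q) sq => [|b] sq; lia.
Qed.

Lemma homog0 d : homog d 0 0.
Proof.
split; first by rewrite size_poly0.
by rewrite /homogenize big1 // => j _; rewrite coef0 rmorph0 mul0r.
Qed.

Lemma homog1 : homog 0 1 1.
Proof.
split; first by rewrite size_poly1.
by rewrite /homogenize big_ord1 coef1 rmorph1 !expr0 !mul1r.
Qed.

Lemma homog_linear a b : homog 1 (a%:P + b *: 'X) (phi a * s + phi b * t).
Proof.
split.
  rewrite (leq_trans (size_polyD _ _)) // geq_max (leq_trans (size_polyC_leq1 _)) //.
  by rewrite (leq_trans (size_scale_leq _ _)) ?size_polyX.
by rewrite /homogenize !big_ord_recr big_ord0 /= !coefD !coefC !coefZ !coefX /=
  mulr0 mulr1 addr0 !add0r !expr0 !expr1 mulr1 mul1r.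
Qed.

Lemma homog_sum d (I : Type) (r : seq I) (p : I -> {poly F}) (P : I -> A) :
  (forall i, homog d (p i) (P i)) ->
  homog d (\sum_(i <- r) p i) (\sum_(i <- r) P i).
Proof.
move=> h; elim: r => [|x r IH]; first by rewrite !big_nil; apply: homog0.
by rewrite !big_cons; apply: homogD.
Qed.

Lemma homog_prod d (I : Type) (r : seq I) (p : I -> {poly F}) (P : I -> A) :
  (forall i, homog d (p i) (P i)) ->
  homog (size r * d) (\prod_(i <- r) p i) (\prod_(i <- r) P i).
Proof.
move=> h; elim: r => [|x r IH]; first by rewrite !big_nil; apply: homog1.
by rewrite !big_cons /= mulSn; apply: homogM.
Qed.

Lemma homogX d i p P : homog d p P -> homog (i * d) (p ^+ i) (P ^+ i).
Proof.
move=> h; elim: i => [|i IH]; first exact: homog1.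
by rewrite !exprS mulSn; apply: homogM.
Qed.

Lemma homog_monomial d i (a1 b1 a2 b2 : F) : (i <= d)%N ->
  homog d ((a1%:P + b1 *: 'X) ^+ i * (a2%:P + b2 *: 'X) ^+ (d - i))
    ((phi a1 * s + phi b1 * t) ^+ i * (phi a2 * s + phi b2 * t) ^+ (d - i)).
Proof.
move=> le_id; have := homogM (homogX i (homog_linear a1 b1))
  (homogX (d - i) (homog_linear a2 b2)).
by rewrite !muln1 subnKC.
Qed.

(** Every Leibniz term is a signed product of [n] entries, each of nominal degree [d]. *)
Lemma homog_det d n (M : 'M[{poly F}]_n) (N : 'M[A]_n) :
  (forall i j, homog d (M i j) (N i j)) -> homog (n * d) (\det M) (\det N).
Proof.
move=> h; rewrite /determinant; apply: homog_sum => sg.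
have hp : homog (n * d) (\prod_i M i (sg i)) (\prod_i N i (sg i)).
  have sz : n = size (index_enum 'I_n) by rewrite -[index_enum _]enumT size_enum_ord.
  by rewrite [X in homog (X * d)]sz; apply: homog_prod.
rewrite !mulr_sign; case: (odd_perm sg) => //.
by have := homogZ (-1) hp; rewrite scaleN1r rmorphN1 mulN1r.
Qed.

(** The coefficient of index j is carried by t^j, so an order of vanishing at 0 turns into
    divisibility by a power of t, here and in [homog_dvd2]. *)
Lemma homog_dvd1 d p P : homog d p P -> p`_0 = 0 -> exists Q, P = t * Q.
Proof.
move=> [_ ->] p0; rewrite /homogenize big_ord_recl p0 rmorph0 mul0r add0r.
eexists; rewrite (_ : \sum_(i < d) _ = t * \sum_(i < d)
  phi p`_i.+1 * (s ^+ (d - i.+1) * t ^+ i)); first by reflexivity.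
rewrite mulr_sumr; apply: eq_bigr => i _.
by rewrite !lift0 exprS; ring.
Qed.

Lemma homog_dvd2 d p P :
  homog d p P -> p`_0 = 0 -> p`_1 = 0 -> exists Q, P = t ^+ 2 * Q.
Proof.
move=> [_ ->] p0 p1; rewrite /homogenize big_ord_recl p0 rmorph0 mul0r add0r.
case: d => [|d]; first by exists 0; rewrite big_ord0 mulr0.
rewrite big_ord_recl p1 rmorph0 mul0r add0r.
eexists; rewrite (_ : \sum_(i < d) _ = t ^+ 2 * \sum_(i < d)
  phi p`_i.+2 * (s ^+ (d.+1 - i.+2) * t ^+ i)); first by reflexivity.
rewrite mulr_sumr; apply: eq_bigr => i _.
by rewrite !lift0 !exprS; ring.
Qed.

End Homogenization.

(** * Matrix polynomials whose determinant has a simple root at 0 *)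

Section SimpleRoot.
Variables (F : fieldType) (n : nat).
Implicit Types (Q : 'M[{poly F}]_n).

Definition mxcoef (p q i : nat) (M : 'M[{poly F}]_(p, q)) : 'M[F]_(p, q) :=
  map_mx (fun f : {poly F} => f`_i) M.

Lemma mxcoef0M p q r (M : 'M[{poly F}]_(p, q)) (N : 'M[{poly F}]_(q, r)) :
  mxcoef 0 (M *m N) = mxcoef 0 M *m mxcoef 0 N.
Proof.
apply/matrixP => i j; rewrite !mxE coef_sum; apply: eq_bigr => h _.
by rewrite !mxE coef0M.
Qed.

Lemma mxcoef1M p q r (M : 'M[{poly F}]_(p, q)) (N : 'M[{poly F}]_(q, r)) :
  mxcoef 1 (M *m N) = mxcoef 0 M *m mxcoef 1 N + mxcoef 1 M *m mxcoef 0 N.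
Proof.
apply/matrixP => i j; rewrite !mxE coef_sum -big_split; apply: eq_bigr => h _.
by rewrite !mxE coefM !big_ord_recr big_ord0 /= add0r.
Qed.

Lemma mxcoef_scalar i (f : {poly F}) : mxcoef i (f%:M : 'M[{poly F}]_n) = (f`_i)%:M.
Proof.
by apply/matrixP => a b; rewrite !mxE; case: eqP; rewrite ?mulr1n ?mulr0n ?coef0.
Qed.

Lemma mxcoef0_polyC p q (M : 'M[F]_(p, q)) : mxcoef 0 (map_mx polyC M) = M.
Proof. by apply/matrixP => a b; rewrite !mxE coefC. Qed.

(** Constant row and column changes bring Q(0) to [pid_mx r]. The rows of index at least [r] then
    vanish at 0, and each gives up one factor X, collected in [diag_mx d]. *)
Lemma det_dvd_corank Q : exists g, \det Q = 'X^(n - \rank (mxcoef 0 Q)) * g.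
Proof.
set Q0 := mxcoef 0 Q; set r := \rank Q0.
pose L := col_ebase Q0; pose U := row_ebase Q0.
have mapV (V : 'M[F]_n) : V \in unitmx ->
    map_mx polyC V *m map_mx polyC (invmx V) = 1%:M /\
    map_mx polyC (invmx V) *m map_mx polyC V = 1%:M.
  by move=> uV; rewrite -!map_mxM mulmxV // mulVmx // map_mx1.
have [LV VL] := mapV L (col_ebase_unit _).
have [UV VU] := mapV U (row_ebase_unit _).
pose N := map_mx polyC (invmx L) *m Q *m map_mx polyC (invmx U).
have QE : Q = map_mx polyC L *m N *m map_mx polyC U.
  by rewrite /N !mulmxA LV mul1mx -mulmxA VU mulmx1.
have N0 : mxcoef 0 N = pid_mx r.
  rewrite /N !mxcoef0M !mxcoef0_polyC -/Q0 -[Q0]mulmx_ebase -/L -/U -/r.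
  by rewrite !mulmxA mulVmx ?col_ebase_unit // mul1mx -mulmxA mulmxV
    ?row_ebase_unit // mulmx1.
clearbody N.
pose d : 'rV[{poly F}]_n := \row_i (if (i < r)%N then 1 else 'X).
pose N' : 'M[{poly F}]_n :=
  \matrix_(i, j) (if (i < r)%N then N i j else drop_poly 1 (N i j)).
have NE : N = diag_mx d *m N'.
  apply/matrixP => i j; rewrite mul_diag_mx !mxE.
  case: ltnP => ir; first by rewrite mul1r.
  have: (mxcoef 0 N) i j = 0 by rewrite N0 mxE ltnNge ir andbF.
  rewrite mxE => Nij0.
  have take0 : take_poly 1 (N i j) = 0.
    by apply/polyP => [[|h]]; rewrite coef_take_poly coef0.
  by rewrite -[LHS](poly_take_drop 1) take0 add0r expr1 mulrC.
have detd : \det (diag_mx d) = 'X^(n - r).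
  rewrite det_diag (eq_bigr (fun i : 'I_n => if (i < r)%N then 1 else 'X)); last first.
    by move=> i _; rewrite mxE.
  rewrite -(big_mkord xpredT (fun i => if (i < r)%N then 1 else 'X)).
  rewrite (big_cat_nat (n := r)) ?rank_leq_row //= big_nat_cond.
  rewrite big1 => [|i /andP[/andP[_ ->]]] //; rewrite mul1r.
  rewrite -prodr_const_nat big_nat_cond [RHS]big_nat_cond.
  by apply: eq_bigr => i /andP[/andP[ri _] _]; rewrite ltnNge ri.
exists (\det (map_mx polyC L) * \det N' * \det (map_mx polyC U)).
by rewrite QE NE !det_mulmx detd; ring.
Qed.

Variables (Q : 'M[{poly F}]_n) (x : 'cV[F]_n) (y : 'rV[F]_n).
Hypotheses (det0 : (\det Q)`_0 = 0) (det1 : (\det Q)`_1 != 0).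
Hypotheses (x0 : x != 0) (Q0x : mxcoef 0 Q *m x = 0).

(** A corank of 2 or more would make X^2 divide the determinant, against [det1]; so the kernel is a
    line, spanned by the nonzero [x]. Several columns are allowed so that the adjugate can be
    treated at once. *)
Lemma kernel_spanned p (Z : 'M[F]_(n, p)) :
  mxcoef 0 Q *m Z = 0 -> exists a, Z = x *m a.
Proof.
move=> Q0Z; move: Q0x; set Q0 := mxcoef 0 Q in Q0Z * => Q0x'.
have rk : (n - \rank Q0 <= 1)%N.
  have [g dE] := det_dvd_corank Q; apply/contraR: det1; rewrite -ltnNge -/Q0.
  by move=> h; rewrite dE -/Q0 coefXnM h.
(* [kermx] and the subspace order concern row spaces, hence the transposes. *)
have sub q (Y : 'M[F]_(n, q)) : Q0 *m Y = 0 -> (Y^T <= kermx Q0^T)%MS.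
  by move=> h; apply/sub_kermxP; rewrite -trmx_mul h trmx0.
have : (kermx Q0^T <= x^T)%MS.
  rewrite -(mxrank_leqif_sup (sub _ _ Q0x')) eqn_leq mxrankS ?sub //=.
  rewrite mxrank_ker !mxrank_tr; apply: leq_trans rk _.
  by rewrite lt0n mxrank_eq0.
move=> kx; have /submxP[a aE] := submx_trans (sub _ _ Q0Z) kx.
by exists a^T; rewrite -[LHS]trmxK aE trmx_mul trmxK.
Qed.

Hypotheses (y0 : y != 0) (yQ0 : y *m mxcoef 0 Q = 0).

(* The coefficient of X in Q * adj Q = det Q gives y Q1 adj(Q)_0 = (det Q)_1 y,
   and adj(Q)_0 factors through x. *)
Lemma simple_root_pairing : (y *m mxcoef 1 Q *m x) 0 0 != 0.
Proof.
have adjE i : mxcoef i (Q *m \adj Q) = ((\det Q)`_i)%:M.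
  by rewrite mul_mx_adj mxcoef_scalar.
have [a aE] : exists a, mxcoef 0 (\adj Q) = x *m a.
  by apply: kernel_spanned; rewrite -mxcoef0M adjE det0 raddf0.
have := adjE 1%N; rewrite mxcoef1M aE => /(congr1 (mulmx y)).
rewrite mulmxDr !mulmxA yQ0 mul0mx add0r mul_mx_scalar => yE.
apply: contraNneq y0 => q0.
have yQx0 : y *m mxcoef 1 Q *m x = 0.
  by apply/matrixP => i j; rewrite !ord1 q0 mxE.
by move: yE; rewrite yQx0 mul0mx => /esym/eqP; rewrite scaler_eq0 (negPf det1).
Qed.

End SimpleRoot.

(** * Restriction of bivariate polynomials to the affine line l + t m *)

Section AffineRestriction.
Variables (R : realType) (l m : R[i] * R[i]).
Local Notation C := R[i].

Definition lin1 : {poly C} := l.1%:P + m.1 *: 'X.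
Definition lin2 : {poly C} := l.2%:P + m.2 *: 'X.

(** The pullback along t |-> l + t m, kept as a polynomial in t so that its Taylor coefficients at
    [l] can be read off. *)
Definition on_line (p : {poly {poly C}}) : {poly C} :=
  (map_poly (comp_poly lin2) p).[lin1].

Lemma on_line_rmorph : exists f : {rmorphism {poly {poly C}} -> {poly C}},
  f =1 on_line.
Proof. by exists (horner_eval lin1 \o map_poly (comp_poly lin2)). Qed.

Lemma on_lineM p q : on_line (p * q) = on_line p * on_line q.
Proof. by have [f fE] := on_line_rmorph; rewrite -!fE rmorphM. Qed.

Lemma on_lineX p i : on_line (p ^+ i) = on_line p ^+ i.
Proof. by have [f fE] := on_line_rmorph; rewrite -!fE rmorphXn. Qed.

Lemma on_line_det n (M : 'M[{poly {poly C}}]_n) :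
  on_line (\det M) = \det (map_mx on_line M).
Proof.
have [f fE] := on_line_rmorph; rewrite -fE -det_map_mx; congr (\det _).
by apply/matrixP => i j; rewrite !mxE fE.
Qed.

Lemma on_line_horner p t :
  (on_line p).[t] = p.[l.1 + m.1 * t, l.2 + m.2 * t].
Proof.
have [l1E l2E] : lin1.[t] = l.1 + m.1 * t /\ lin2.[t] = l.2 + m.2 * t.
  by rewrite !hornerE.
rewrite -l1E -l2E /on_line.
have := horner_map (horner_eval t) (map_poly (comp_poly lin2) p) lin1.
have := horner_map (horner_eval lin2.[t]) p lin1.[t]%:P.
rewrite /= !horner_evalE hornerC => <- <-; rewrite -map_poly_comp.
congr (_.[_]); apply: eq_map_poly => q /=.
by rewrite !horner_evalE horner_comp.
Qed.

Lemma on_line_coef0 p : (on_line p)`_0 = p.[l.1, l.2].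
Proof. by rewrite -horner_coef0 on_line_horner !mulr0 !addr0. Qed.

(** The chain rule at t = 0, by induction on [p] in Horner form. *)
Lemma on_line_coef1 p :
  (on_line p)`_1 = m.1 * p^`().[l.1, l.2]
    + m.2 * (map_poly (fun q : {poly C} => q^`()) p).[l.1, l.2].
Proof.
elim/poly_ind: p => [|p c IH].
  by rewrite /on_line !map_poly0 derivC !horner0 coef0 !mulr0 addr0.
have [f fE] := on_line_rmorph.
have cE : (c \Po lin2)`_1 = m.2 * c^`().[l.2].
  rewrite -[LHS]mulr1n -[_ *+ 1]/(_ *+ (0.+1)) -coef_deriv -horner_coef0.
  rewrite deriv_comp hornerM horner_comp /lin2 derivD derivC add0r derivZ derivX.
  by rewrite hornerD !hornerZ !hornerC hornerX mulr0 addr0 mulr1 mulrC.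
have -> : (on_line (p * 'X + c%:P))`_1 =
    (on_line p)`_1 * l.1 + (on_line p)`_0 * m.1 + m.2 * c^`().[l.2].
  rewrite -!fE rmorphD rmorphM !fE /on_line map_polyX map_polyC hornerX hornerC.
  rewrite coefD cE coefM !big_ord_recr big_ord0 /= add0r.
  rewrite /lin1 !coefD !coefC !coefZ !coefX /=; ring.
have -> : map_poly (fun q : {poly C} => q^`()) (p * 'X + c%:P) =
   map_poly (fun q : {poly C} => q^`()) p * 'X + (c^`())%:P.
  apply/polyP => i; rewrite coefD coefMX !coef_map_id0 ?deriv0 //.
  by rewrite coefD coefMX !coefC derivD; case: i => [|i];
    rewrite //= ?coef_map_id0 ?deriv0 ?derivC.
rewrite derivD derivM derivX derivC addr0 mulr1 !hornerE IH on_line_coef0 /=.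
by ring.
Qed.

End AffineRestriction.

(** * The restricted matrix polynomial and the algebraic test for a simple eigenvalue *)

Section Pencil.
Variables (R : realType) (n k : nat).
Local Notation C := R[i].
Implicit Types (B : coeffs R n k) (l m : C * C).

Definition pencil B l m : 'M[{poly C}]_n :=
  \sum_(i < k.+1) (lin1 l m ^+ i * lin2 l m ^+ (k - i)) *: map_mx polyC (B i).

Lemma pencil_on_line B l m : pencil B l m = map_mx (on_line l m) (hmxpoly B).
Proof.
have [f fE] := on_line_rmorph l m.
apply/matrixP => a b; rewrite mxE -fE /pencil /hmxpoly !summxE rmorph_sum.
apply: eq_bigr => i _; rewrite !mxE !rmorphM !rmorphXn /= !fE.
rewrite /on_line !map_polyX !map_polyC /= comp_polyX comp_polyC.
by rewrite !hornerX !hornerC.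
Qed.

Lemma det_pencil B l m : \det (pencil B l m) = on_line l m (\det (hmxpoly B)).
Proof. by rewrite pencil_on_line on_line_det. Qed.

Lemma pencil_coef0 B l m : mxcoef 0 (pencil B l m) = evalmx (hmxpoly B) l.
Proof.
by apply/matrixP => a b; rewrite pencil_on_line !mxE on_line_coef0.
Qed.

Lemma pencil_coef1 B l m : mxcoef 1 (pencil B l m) =
  m.1 *: evalmx (dalpha (hmxpoly B)) l + m.2 *: evalmx (dbeta (hmxpoly B)) l.
Proof.
by apply/matrixP => a b; rewrite pencil_on_line !mxE on_line_coef1.
Qed.

Lemma pencil_horner B l m t :
  map_mx (horner_eval t) (pencil B l m) =
    evalmx (hmxpoly B) (l.1 + m.1 * t, l.2 + m.2 * t).
Proof.
by apply/matrixP => a b; rewrite pencil_on_line !mxE /horner_eval on_line_horner.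
Qed.

(** If s, t are the coordinates of (alpha, beta) with respect to [l] and [m], homogeneity of P
    recovers its determinant from the restriction to the affine line s = 1. *)
Lemma pencil_homog (phi : {rmorphism C -> {poly {poly C}}}) B l m s t :
  (forall c, phi c = c%:P%:P) ->
  phi l.1 * s + phi m.1 * t = 'X -> phi l.2 * s + phi m.2 * t = 'Y ->
  homog phi s t (n * k) (\det (pencil B l m)) (\det (hmxpoly B)).
Proof.
move=> phiE Xst Yst; apply: homog_det => a b.
rewrite /pencil /hmxpoly !summxE; apply: homog_sum => i.
have := homogZ (B i a b) (homog_monomial phi s t l.1 m.1 l.2 m.2 (leq_ord i)).
by rewrite Xst Yst phiE -mul_polyC !mxE mulrC [_%:P%:P * _]mulrC.
Qed.

(** Cramer's rule solves (alpha, beta) = s l + t m; the coordinate t is the line form divided by the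
    determinant D. *)
Lemma det_pencil_homog B l m :
  let D := l.2 * m.1 - l.1 * m.2 in D != 0 ->
  exists (phi : {rmorphism C -> {poly {poly C}}}) s,
    homog phi s ((D^-1)%:P%:P * line_form l) (n * k)
      (\det (pencil B l m)) (\det (hmxpoly B)).
Proof.
move=> D D0.
have [phi phiE] : exists phi : {rmorphism C -> {poly {poly C}}},
  forall c, phi c = c%:P%:P by exists (polyC \o polyC).
pose s : {poly {poly C}} :=
  (D^-1)%:P%:P * (m.1%:P%:P * 'Y - m.2%:P%:P * 'X).
have DV : (D^-1)%:P%:P * D%:P%:P = 1 :> {poly {poly C}}.
  by rewrite -!polyCM mulVf.
have DE : D%:P%:P = l.2%:P%:P * m.1%:P%:P - l.1%:P%:P * m.2%:P%:P
    :> {poly {poly C}} by rewrite /D !polyCB !polyCM.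
exists phi, s; apply: pencil_homog => //;
  by rewrite !phiE /s /line_form -[RHS]mul1r -DV DE; ring.
Qed.

(** Multiplicity along the line equals the order of vanishing of the restriction: low coefficients
    that vanish give factors of the line form by homogenization, and conversely the line form
    restricts to a multiple of X. *)
Lemma simple_eigenvalueP B l m :
  l != (0, 0) -> l.2 * m.1 - l.1 * m.2 != 0 ->
  simple_eigenvalue B l <->
  (\det (pencil B l m))`_0 = 0 /\ (\det (pencil B l m))`_1 != 0.
Proof.
move=> l0 D0; have [phi [s]] := det_pencil_homog B D0.
set D := _ - _; set t := _ * line_form l => hom.
split=> [[[_ rt] [_ nd]]|[f0 f1]].
  have f0 : (\det (pencil B l m))`_0 = 0 by rewrite det_pencil on_line_coef0.
  split=> //; apply/eqP => f1; apply: nd.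
  have [Q QE] := homog_dvd2 hom f0 f1.
  exists ((D^-1)%:P%:P ^+ 2 * Q); rewrite QE /t.
  set L := line_form l; set c := (D^-1)%:P%:P; ring.
split; first by split=> //; rewrite -(on_line_coef0 l m) -det_pencil.
split.
  have [Q QE] := homog_dvd1 hom f0.
  by exists ((D^-1)%:P%:P * Q); rewrite QE /t /D expr1; ring.
move=> [q qE]; move/negP: f1; apply; rewrite det_pencil qE on_lineM on_lineX.
(* The line form vanishes at [l], so only its value D on the direction [m] remains. *)
have -> : on_line l m (line_form l) = D *: 'X.
  have [f fE] := on_line_rmorph l m.
  rewrite -fE /line_form rmorphB !rmorphM /= !fE /on_line.
  rewrite !map_polyX !map_polyC /= !comp_polyX !comp_polyC !hornerX !hornerC.
  rewrite /lin1 /lin2 -!mul_polyC polyCB !polyCM; ring.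
by rewrite exprZn -scalerAl coefZ coefXnM mulr0.
Qed.

End Pencil.

(** * The real-valued complex modulus *)

Section Modulus.
Variable R : realType.
Local Notation C := R[i].
Implicit Types z w : C.

Lemma cabs_ge0 z : 0 <= cabs z.
Proof. by case: z => a b; rewrite /cabs /= sqrtr_ge0. Qed.

Lemma cabs0 : cabs (0 : C) = 0. Proof. exact: ComplexField.Normc.normc0. Qed.

Lemma cabs1 : cabs (1 : C) = 1. Proof. exact: ComplexField.Normc.normc1. Qed.

Lemma cabsM z w : cabs (z * w) = cabs z * cabs w.
Proof. exact: ComplexField.Normc.normcM. Qed.

Lemma cabsV z : cabs z^-1 = (cabs z)^-1.
Proof. exact: ComplexField.Normc.normcV. Qed.

Lemma cabs_le z w : cabs (z + w) <= cabs z + cabs w.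
Proof. exact: le_normcD. Qed.

Lemma cabsN z : cabs (- z) = cabs z. Proof. exact: normcN. Qed.

Lemma cabs_eq0 z : (cabs z == 0) = (z == 0).
Proof.
by apply/eqP/eqP => [/ComplexField.Normc.eq0_normc //|->]; exact: cabs0.
Qed.

Lemma cabs_gt0 z : (0 < cabs z) = (z != 0).
Proof. by rewrite lt_def cabs_ge0 andbT cabs_eq0. Qed.

Lemma cabsX z i : cabs (z ^+ i) = cabs z ^+ i.
Proof. by elim: i => [|i IH]; rewrite ?expr0 ?cabs1 // !exprS cabsM IH. Qed.

Lemma cabs_distC z w : cabs (z - w) = cabs (w - z).
Proof. by rewrite -cabsN opprB. Qed.

Lemma cabs_dist_le z w : `|cabs z - cabs w| <= cabs (z + w).
Proof.
have := cabs_le (z + w) (- w); have := cabs_le (z + w) (- z).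
rewrite addrK [X in cabs (X - z)]addrC addrK !cabsN.
by move=> h1 h2; rewrite ler_norml; apply/andP; split; lra.
Qed.

Lemma cabs_sum (I : Type) (r : seq I) (P : pred I) (f : I -> C) :
  cabs (\sum_(i <- r | P i) f i) <= \sum_(i <- r | P i) cabs (f i).
Proof.
elim/big_rec2: _ => [|i a b _ h]; first by rewrite cabs0.
by apply: le_trans (cabs_le _ _) _; rewrite lerD2l.
Qed.

Lemma cabs_real (r : R) : cabs (r%:C)%C = `|r|.
Proof. by rewrite /cabs /= expr0n addr0 sqrtr_sqr. Qed.

Lemma cabs_conj z : cabs z^* = cabs z.
Proof.
have h : cabs (z^*)%C = cabs z by case: z => a b; rewrite /cabs /= sqrrN.
by rewrite -h.
Qed.

Lemma mul_conj z : z * z^* = ((cabs z ^+ 2)%:C)%C.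
Proof.
rewrite -normCK -[`|z|]/((cabs z)%:C)%C.
by rewrite -rmorphXn.
Qed.

End Modulus.

(** * Euclidean, entrywise and spectral norms *)

Section Norms.
Variable R : realType.
Local Notation C := R[i].

(** The difference of the two sides is half the double sum of (a_i b_j - a_j b_i)^2. *)
Lemma CauchySchwarz_sum n (a b : 'I_n -> R) :
  (\sum_i a i * b i) ^+ 2 <= (\sum_i a i ^+ 2) * (\sum_i b i ^+ 2).
Proof.
have : 0 <= \sum_i \sum_j (a i * b j - a j * b i) ^+ 2.
  by apply: sumr_ge0 => i _; apply: sumr_ge0 => j _; apply: sqr_ge0.
have -> : \sum_i \sum_j (a i * b j - a j * b i) ^+ 2 =
    (\sum_i a i ^+ 2) * (\sum_i b i ^+ 2) +
    (\sum_i b i ^+ 2) * (\sum_i a i ^+ 2) -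
    2 * ((\sum_i a i * b i) * (\sum_i a i * b i)).
  rewrite !mulr_suml mulr_sumr -big_split -sumrB /=; apply: eq_bigr => i _.
  rewrite !mulr_sumr -big_split -sumrB /=; apply: eq_bigr => j _; ring.
by rewrite expr2; lra.
Qed.

Section Nrm1.
Variables p q : nat.
Implicit Types M N : 'M[C]_(p, q).

(** The entrywise l1 norm is submultiplicative for all rectangular shapes; it serves wherever the
    constants do not matter. *)
Definition nrm1 M : R := \sum_i \sum_j cabs (M i j).

Lemma nrm1_ge0 M : 0 <= nrm1 M.
Proof. by apply: sumr_ge0 => i _; apply: sumr_ge0 => j _; apply: cabs_ge0. Qed.

Lemma nrm1D M N : nrm1 (M + N) <= nrm1 M + nrm1 N.
Proof.
rewrite /nrm1 -big_split; apply: ler_sum => i _.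
by rewrite -big_split; apply: ler_sum => j _; rewrite mxE; apply: cabs_le.
Qed.

Lemma nrm1Z c M : nrm1 (c *: M) = cabs c * nrm1 M.
Proof.
rewrite /nrm1 mulr_sumr; apply: eq_bigr => i _; rewrite mulr_sumr.
by apply: eq_bigr => j _; rewrite mxE cabsM.
Qed.

Lemma nrm1N M : nrm1 (- M) = nrm1 M.
Proof.
by rewrite -scaleN1r nrm1Z -[-1]mul1r mulrN cabsN mulr1 cabs1 mul1r.
Qed.

Lemma cabs_nrm1 M i j : cabs (M i j) <= nrm1 M.
Proof.
rewrite /nrm1 (bigD1 i) //= (bigD1 j) //= -addrA lerDl addr_ge0 //.
  by apply: sumr_ge0 => h _; apply: cabs_ge0.
by apply: sumr_ge0 => h _; apply: sumr_ge0 => h' _; apply: cabs_ge0.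
Qed.

Lemma nrm1_gt0 M : M != 0 -> 0 < nrm1 M.
Proof.
move=> M0; rewrite lt_def nrm1_ge0 andbT; apply: contra M0 => /eqP M0.
apply/eqP/matrixP => i j; rewrite mxE; apply/eqP; rewrite -cabs_eq0.
by rewrite eq_le cabs_ge0 andbT -M0 cabs_nrm1.
Qed.

Lemma nrm1_sum (I : Type) (r : seq I) (f : I -> 'M[C]_(p, q)) :
  nrm1 (\sum_(i <- r) f i) <= \sum_(i <- r) nrm1 (f i).
Proof.
elim/big_rec2: _ => [|i a b _ h].
  by rewrite /nrm1 big1 // => i _; rewrite big1 // => j _; rewrite mxE cabs0.
by apply: le_trans (nrm1D _ _) _; rewrite lerD2l.
Qed.

End Nrm1.

Lemma nrm1M p q r (M : 'M[C]_(p, q)) (N : 'M[C]_(q, r)) :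
  nrm1 (M *m N) <= nrm1 M * nrm1 N.
Proof.
rewrite /nrm1 mulr_suml; apply: ler_sum => i _.
apply: (@le_trans _ _ (\sum_j \sum_h cabs (M i h) * cabs (N h j))).
  apply: ler_sum => j _; rewrite mxE; apply: le_trans (cabs_sum _ _ _) _.
  by apply: ler_sum => h _; rewrite cabsM.
rewrite exchange_big mulr_suml; apply: ler_sum => h _ /=.
rewrite -mulr_sumr ler_wpM2l ?cabs_ge0 // [leRHS](bigD1 h) //= lerDl.
by apply: sumr_ge0 => i' _; apply: sumr_ge0 => j _; apply: cabs_ge0.
Qed.

Variable n : nat.
Implicit Types (u v : 'cV[C]_n) (M : 'M[C]_n).

Lemma norm2_ge0 v : 0 <= norm2 v. Proof. exact: sqrtr_ge0. Qed.

Lemma norm2_sqr v : norm2 v ^+ 2 = \sum_i cabs (v i 0) ^+ 2.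
Proof. by rewrite sqr_sqrtr // sumr_ge0 // => i _; apply: sqr_ge0. Qed.

Lemma cdotE u v : (u ^t* *m v) 0 0 = \sum_i (u i 0)^* * v i 0.
Proof. by rewrite mxE; apply: eq_bigr => i _; rewrite !mxE. Qed.

Lemma cdot_self v : (v ^t* *m v) 0 0 = ((norm2 v ^+ 2)%:C)%C.
Proof.
rewrite cdotE norm2_sqr rmorph_sum; apply: eq_bigr => i _.
by rewrite mulrC mul_conj.
Qed.

Lemma norm2Z c v : norm2 (c *: v) = cabs c * norm2 v.
Proof.
rewrite /norm2 (eq_bigr (fun i => cabs c ^+ 2 * cabs (v i 0) ^+ 2)).
  by rewrite -mulr_sumr sqrtrM ?sqr_ge0 // sqrtr_sqr ger0_norm ?cabs_ge0.
by move=> i _; rewrite mxE cabsM exprMn.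
Qed.

Lemma norm2_gt0 v : v != 0 -> 0 < norm2 v.
Proof.
move=> v0; rewrite lt_def norm2_ge0 andbT; apply: contra v0 => /eqP h.
have : norm2 v ^+ 2 = 0 by rewrite h expr0n.
rewrite norm2_sqr => /eqP; rewrite psumr_eq0 => [/allP z|i _]; last exact: sqr_ge0.
apply/eqP/matrixP => i j; rewrite ord1 mxE; apply/eqP.
by have := z i (mem_index_enum _); rewrite sqrf_eq0 cabs_eq0.
Qed.

Lemma cabs_norm2 v i : cabs (v i 0) <= norm2 v.
Proof.
rewrite -(ler_pXn2r (_ : 0 < 2)%N) ?nnegrE ?cabs_ge0 ?norm2_ge0 //.
rewrite norm2_sqr (bigD1 i) //= lerDl.
by apply: sumr_ge0 => h _; apply: sqr_ge0.
Qed.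

Lemma norm2_nrm1 v : norm2 v <= nrm1 v.
Proof.
rewrite -(ler_pXn2r (_ : 0 < 2)%N) ?nnegrE ?nrm1_ge0 ?norm2_ge0 //.
rewrite norm2_sqr expr2 {1}/nrm1 mulr_suml; apply: ler_sum => i _.
by rewrite big_ord1 expr2 ler_wpM2l ?cabs_ge0 ?cabs_nrm1.
Qed.

Lemma nrm1_norm2 v : nrm1 v <= n%:R * norm2 v.
Proof.
rewrite /nrm1 mulr_natl -[X in _ *+ X](card_ord n) -sumr_const.
by apply: ler_sum => i _; rewrite big_ord1 cabs_norm2.
Qed.

Lemma cdot_le u v : cabs ((u ^t* *m v) 0 0) <= norm2 u * norm2 v.
Proof.
rewrite cdotE; apply: le_trans (cabs_sum _ _ _) _.
rewrite -(ler_pXn2r (_ : 0 < 2)%N) ?nnegrE ?mulr_ge0 ?norm2_ge0 //; last first.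
  by apply: sumr_ge0 => i _; apply: cabs_ge0.
rewrite exprMn !norm2_sqr; under eq_bigr do rewrite cabsM cabs_conj.
exact: CauchySchwarz_sum.
Qed.

(** Makes the [sup] in [spectral_norm] a genuine supremum: the set contains the value at 0 and is
    bounded through [nrm1]. *)
Lemma spectral_has_sup M :
  has_sup [set norm2 (M *m v) | v in [set v : 'cV[C]_n | norm2 v <= 1]].
Proof.
split.
  exists (norm2 (M *m 0)), 0 => //=.
  by rewrite -(scale0r (0 : 'cV[C]_n)) norm2Z cabs0 mul0r.
exists (nrm1 M * n%:R) => _ [v /= v1 <-].
apply: le_trans (norm2_nrm1 _) (le_trans (nrm1M _ _) _).
rewrite ler_wpM2l ?nrm1_ge0 //; apply: le_trans (nrm1_norm2 _) _.
by rewrite -[leRHS]mulr1 ler_wpM2l.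
Qed.

Lemma norm2_mul M v : norm2 (M *m v) <= spectral_norm M * norm2 v.
Proof.
have [->|v0] := eqVneq v 0.
  by rewrite mulmx0 -(scale0r (0 : 'cV[C]_n)) !norm2Z cabs0 !mul0r mulr0.
have v_gt0 := norm2_gt0 v0.
rewrite -ler_pdivrMr //; apply: ub_le_sup; first by case: (spectral_has_sup M).
exists (((norm2 v)^-1)%:C%C *: v) => /=.
  by rewrite norm2Z cabs_real ger0_norm ?invr_ge0 ?norm2_ge0 // mulVf ?gt_eqF.
rewrite -scalemxAr norm2Z cabs_real ger0_norm ?invr_ge0 ?norm2_ge0 //.
by rewrite mulrC.
Qed.

Lemma spectral_norm_le M (c : R) :
  0 <= c -> (forall v, norm2 (M *m v) <= c * norm2 v) -> spectral_norm M <= c.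
Proof.
move=> c0 h; apply: ge_sup; first by case: (spectral_has_sup M).
move=> _ [v /= v1 <-]; apply: le_trans (h v) _.
by rewrite -[leRHS]mulr1 ler_wpM2l.
Qed.

Lemma spectral_norm_ge0 M : 0 <= spectral_norm M.
Proof.
apply: ub_le_sup; first by case: (spectral_has_sup M).
exists 0 => /=; rewrite ?mulmx0 -(scale0r (0 : 'cV[C]_n)) norm2Z cabs0 mul0r //.
Qed.

Lemma cabs_spectral M i j : cabs (M i j) <= spectral_norm M.
Proof.
have -> : M i j = (M *m delta_mx j 0) i (0 : 'I_1).
  by rewrite -colE mxE.
apply: le_trans (cabs_norm2 _ _) _; apply: le_trans (norm2_mul _ _) _.
rewrite -[leRHS]mulr1 ler_wpM2l ?spectral_norm_ge0 //.
rewrite -(ler_pXn2r (_ : 0 < 2)%N) ?nnegrE ?norm2_ge0 // norm2_sqr.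
rewrite (bigD1 j) //= mxE !eqxx cabs1 big1 ?addr0 ?expr1n // => h hj.
by rewrite mxE (negPf hj) cabs0 expr0n.
Qed.

Lemma nrm1_spectral M : nrm1 M <= n%:R * n%:R * spectral_norm M.
Proof.
have sumc (c : R) : \sum_(i < n) c = n%:R * c.
  by rewrite sumr_const card_ord mulr_natl.
rewrite -mulrA -!sumc; apply: ler_sum => i _.
by apply: ler_sum => j _; apply: cabs_spectral.
Qed.

(** The matrix sends w to a multiple of [u] by the inner product of [v] and w, which Cauchy-Schwarz
    bounds. *)
Lemma spectral_norm_rank1 (c : C) u v :
  spectral_norm (c *: (u *m v ^t*)) <= cabs c * (norm2 u * norm2 v).
Proof.
apply: spectral_norm_le => [|w]; first by rewrite !mulr_ge0 ?cabs_ge0 ?norm2_ge0.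
rewrite -scalemxAl norm2Z -!mulrA ler_wpM2l ?cabs_ge0 // -mulmxA.
rewrite [v ^t* *m w]mx11_scalar mul_mx_scalar norm2Z mulrC.
by rewrite ler_wpM2l ?norm2_ge0 ?cdot_le.
Qed.

End Norms.

(** * Chordal distance and the affine chart l + t m *)

Section Chordal.
Variable R : realType.
Local Notation C := R[i].
Implicit Types l : C * C.

Definition wedge l l' : C := l.1 * l'.2 - l.2 * l'.1.

Definition normal_dir l : C * C := (l.2^*, - l.1^*).

Definition along l l' (t : C) : C * C := (l.1 + l'.1 * t, l.2 + l'.2 * t).

Lemma col2_norm l : norm2 (col2 l) ^+ 2 = cabs l.1 ^+ 2 + cabs l.2 ^+ 2.
Proof. by rewrite norm2_sqr !big_ord_recl big_ord0 addr0 !mxE. Qed.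

Lemma col2_gt0 l : l != (0, 0) -> 0 < norm2 (col2 l).
Proof.
move=> l0; apply: norm2_gt0; apply: contra l0 => /eqP/matrixP h.
have := h 0 0; have := h 1 0; rewrite !mxE /=.
by case: l {h} => a b /= -> ->.
Qed.

(** Lagrange's identity, that is cos^2 + sin^2 = 1 without denominators; it identifies the wedge as
    the unnormalized sine. *)
Lemma lagrange l l' :
  cabs (((col2 l') ^t* *m col2 l) 0 0) ^+ 2 + cabs (wedge l l') ^+ 2 =
  (norm2 (col2 l) * norm2 (col2 l')) ^+ 2.
Proof.
rewrite exprMn !col2_norm cdotE !big_ord_recl big_ord0 addr0 !mxE /=.
case: l l' => [[a b] [c d]] [[a' b'] [c' d']]; rewrite /wedge /=.
by rewrite !sqr_sqrtr ?addr_ge0 ?sqr_ge0 //; ring.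
Qed.

Lemma chordalE l l' : l != (0, 0) -> l' != (0, 0) ->
  chordal l l' = cabs (wedge l l') / (norm2 (col2 l) * norm2 (col2 l')).
Proof.
move=> /col2_gt0 l0 /col2_gt0 l'0; rewrite /chordal /line_angle.
set N := norm2 _ * norm2 _; set x := cabs ((_ *m _) _ _).
have N0 : 0 < N by rewrite mulr_gt0.
have xN : x <= N by rewrite /x /N [leRHS]mulrC; apply: cdot_le.
have x0 : 0 <= x by apply: cabs_ge0.
rewrite sin_acos; last first.
  by rewrite ler_pdivrMr // mul1r xN andbT; apply: le_trans (divr_ge0 x0 (ltW N0)).
have -> : 1 - (x / N) ^+ 2 = (cabs (wedge l l') / N) ^+ 2.
  rewrite !exprMn exprVn -[X in X - _](@mulfV _ (N ^+ 2)).
    by rewrite -mulrBl -lagrange -/x addrC addKr.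
  by rewrite expf_neq0 // gt_eqF.
by rewrite sqrtr_sqr ger0_norm // divr_ge0 ?cabs_ge0 // ltW.
Qed.

Lemma wedge_along l t : cabs (wedge l (along l (normal_dir l) t)) =
  cabs t * norm2 (col2 l) ^+ 2.
Proof.
rewrite col2_norm -[_ + _ in RHS]ger0_norm ?addr_ge0 ?sqr_ge0 //.
rewrite -cabs_real -cabsM -cabsN rmorphD /= -!mul_conj; congr (cabs _).
by rewrite /wedge /along /normal_dir /=; ring.
Qed.

(** Pythagoras: the normal direction is orthogonal to [l] and has the same length. *)
Lemma norm_along l t : norm2 (col2 (along l (normal_dir l) t)) =
  norm2 (col2 l) * Num.sqrt (1 + cabs t ^+ 2).
Proof.
apply/eqP; rewrite -(@eqrXn2 _ 2) ?mulr_ge0 ?norm2_ge0 ?sqrtr_ge0 //; apply/eqP.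
rewrite exprMn !col2_norm.
case: l t => [[a b] [c d]] [e f]; rewrite /along /normal_dir /=.
by rewrite !sqr_sqrtr ?addr_ge0 ?sqr_ge0 //; ring.
Qed.

Lemma along_neq0 l t : l != (0, 0) -> along l (normal_dir l) t != (0, 0).
Proof.
move=> l0; apply/eqP => h; have := norm_along l t; rewrite h => /esym/eqP.
have -> : norm2 (col2 (0, 0) : 'cV[C]_2) = 0.
  have -> : col2 ((0, 0) : C * C) = 0 *: 0.
    by apply/matrixP => i j; rewrite scale0r !mxE; case: eqP.
  by rewrite norm2Z cabs0 mul0r.
rewrite mulf_eq0 gt_eqF ?col2_gt0 //= sqrtr_eq0 leNgt.
by rewrite ltr_wpDr ?sqr_ge0.
Qed.

Lemma chordal_along l t : l != (0, 0) ->
  chordal l (along l (normal_dir l) t) = cabs t / Num.sqrt (1 + cabs t ^+ 2).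
Proof.
move=> l0; have N0 := col2_gt0 l0.
rewrite chordalE ?along_neq0 // wedge_along norm_along.
have s0 : 0 < Num.sqrt (1 + cabs t ^+ 2).
  by rewrite sqrtr_gt0 ltr_wpDr ?sqr_ge0.
by field; rewrite !gt_eqF.
Qed.

(** The bounds 1 <= sqrt (1 + s^2) <= 1 + s replace the square root by rational expressions that
    agree to first order in s = |t|. *)
Lemma chordal_along_le l t : l != (0, 0) ->
  cabs t / (1 + cabs t) <= chordal l (along l (normal_dir l) t) <= cabs t.
Proof.
move=> l0; rewrite chordal_along //; have t0 := cabs_ge0 t.
have s1 : 1 <= Num.sqrt (1 + cabs t ^+ 2).
  by rewrite -[leLHS]sqrtr1 ler_wsqrtr // lerDl sqr_ge0.
have s2 : Num.sqrt (1 + cabs t ^+ 2) <= 1 + cabs t.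
  have -> : 1 + cabs t = Num.sqrt ((1 + cabs t) ^+ 2).
    by rewrite sqrtr_sqr ger0_norm // addr_ge0.
  by rewrite ler_wsqrtr // sqrrD expr1n mul1r lerD2r lerDl mulrn_wge0.
apply/andP; split.
  by rewrite ler_wpM2l // lef_pV2 // posrE; lra.
by rewrite ler_pdivrMr ?(lt_le_trans ltr01) // ler_peMr.
Qed.

Lemma chordal_scale l l' (c : C) : c != 0 -> l != (0, 0) -> l' != (0, 0) ->
  chordal l (c * l'.1, c * l'.2) = chordal l l'.
Proof.
move=> c0 l0 l'0; have [L0 L'0] := (col2_gt0 l0, col2_gt0 l'0).
have nE : norm2 (col2 (c * l'.1, c * l'.2)) = cabs c * norm2 (col2 l').
  by rewrite -norm2Z; congr norm2; apply/matrixP => i j; rewrite !mxE; case: eqP.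
have cl0 : (c * l'.1, c * l'.2) != (0, 0).
  apply: contra l'0; rewrite [l' in l' == _]surjective_pairing; rewrite !xpair_eqE !mulf_eq0.
  by rewrite (negPf c0).
rewrite !chordalE // nE.
have -> : wedge l (c * l'.1, c * l'.2) = c * wedge l l' by rewrite /wedge /=; ring.
have C0 : cabs c != 0 by rewrite cabs_eq0.
by rewrite cabsM; field; rewrite C0 !gt_eqF.
Qed.

(** A line not orthogonal to [l] meets the affine line l + t m. *)
Lemma chordal_lt1_along l l' : l != (0, 0) -> l' != (0, 0) -> chordal l l' < 1 ->
  exists c t, [/\ c != 0 & l' = (c * (along l (normal_dir l) t).1,
                                 c * (along l (normal_dir l) t).2)].
Proof.
move=> l0 l'0 h; have [L0 L'0] := (col2_gt0 l0, col2_gt0 l'0).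
pose N : C := l.1 * l.1^* + l.2 * l.2^*.
have N0 : N != 0.
  rewrite /N !mul_conj -rmorphD -col2_norm -cabs_eq0 cabs_real.
  by rewrite normr_eq0 expf_neq0 // gt_eqF.
(* The component of [l'] on [l] in the orthogonal basis formed by [l] and its normal; the wedge
   below is, up to sign and the factor N, the other component. *)
pose c := (l.1^* * l'.1 + l.2^* * l'.2) / N.
have c0 : c != 0.
  (* With a zero inner product, Lagrange's identity would make the chordal distance equal to 1. *)
  rewrite /c mulf_neq0 ?invr_neq0 //; apply/eqP => d0; move: h.
  have := lagrange l' l; rewrite cdotE !big_ord_recl big_ord0 addr0 !mxE /= d0.
  rewrite cabs0 expr0n add0r => /eqP; rewrite eqrXn2 ?mulr_ge0 ?norm2_ge0 ?cabs_ge0 //.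
  have -> : wedge l' l = - wedge l l' by rewrite /wedge; ring.
  rewrite cabsN chordalE // => /eqP ->.
  by rewrite [X in X / _]mulrC divff ?ltxx // mulf_neq0 ?gt_eqF.
exists c, ((- wedge l l' / N) / c); split=> //.
rewrite [l']surjective_pairing /along /normal_dir /=; congr (_, _).
  rewrite mulrDr mulrCA [_ / c]mulrC mulVKf // /c /wedge.
  by apply: (mulfI N0); rewrite /N; field.
rewrite mulrDr mulrCA [_ / c]mulrC mulVKf // /c /wedge.
by apply: (mulfI N0); rewrite /N; field.
Qed.

End Chordal.

(** * Locating a small root from the two lowest coefficients *)

Section SmallRoot.
Variable R : realType.
Local Notation C := R[i].

(* For f = c * prod (X - t_i), f_1 / f_0 = - sum 1 / t_i. *)
Lemma small_root (f : {poly C}) (r : R) : 0 < r ->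
  (size f).-1%:R * cabs f`_0 < r * cabs f`_1 -> exists2 t, root f t & cabs t < r.
Proof.
move=> r0 h; have f0 : f != 0.
  by apply: contraTneq h => ->; rewrite !coef0 cabs0 !mulr0 ltxx.
have [rs fE] := closed_field_poly_normal f.
have [/hasP[t trs tr]|/hasPn big] := boolP (has (fun t => cabs t < r) rs).
  by exists t => //; rewrite fE rootZ ?lead_coef_eq0 // root_prod_XsubC.
have {}big t : t \in rs -> r <= cabs t by move=> /big; rewrite -leNgt.
have sz : (size f).-1 = size rs.
  by rewrite fE size_scale ?lead_coef_eq0 // size_prod_XsubC.
(* If all roots have modulus at least r, the sum of the 1/t_i has modulus at most (number of
   roots)/r. Cleared of denominators and of the leading coefficient, this goes by induction on the
   list of roots. *)
suff bd : r * cabs (\prod_(z <- rs) ('X - z%:P))`_1 <=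
    (size rs)%:R * cabs (\prod_(z <- rs) ('X - z%:P))`_0.
  have cE i : f`_i = lead_coef f * (\prod_(z <- rs) ('X - z%:P))`_i.
    by rewrite {1}fE coefZ.
  move: h; rewrite sz !cE !cabsM mulrCA [ltRHS]mulrCA.
  by rewrite ltr_pM2l ?cabs_gt0 ?lead_coef_eq0 // ltNge bd.
elim: rs big {fE sz} => [|a rs IH] big.
  by rewrite !big_nil coef1 cabs0 mulr0 mul0r.
rewrite !big_cons; set g := \prod_(_ <- _) _ in IH *.
have {}IH : r * cabs g`_1 <= (size rs)%:R * cabs g`_0.
  by apply: IH => t trs; apply: big; rewrite in_cons trs orbT.
have ra := big a (mem_head _ _).
rewrite !mulrBl !coefB !coefXM !coefCM /= sub0r cabsN cabsM -natr1.
apply: (@le_trans _ _ (r * (cabs g`_0 + cabs a * cabs g`_1))).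
  by rewrite ler_pM2l // -cabsM -(cabsN (a * _)) cabs_le.
have -> : r * (cabs g`_0 + cabs a * cabs g`_1) =
  r * cabs g`_0 + cabs a * (r * cabs g`_1) by ring.
rewrite mulrDl mul1r [leLHS]addrC [X in _ <= X + _]mulrCA lerD //.
  by rewrite ler_wpM2l ?cabs_ge0.
by rewrite ler_wpM2r ?cabs_ge0.
Qed.

End SmallRoot.

Lemma size_deriv_le (R : nzRingType) (p : {poly R}) : (size p^`() <= size p)%N.
Proof.
by have [->|/lt_size_deriv/ltnW //] := eqVneq p 0; rewrite derivC size_poly0.
Qed.

(** * Limits of complex numbers, polynomials and determinants along a filter *)

Section Tends.
Variables (R : realType) (T : Type) (F : set_system T).
Hypothesis FF : Filter F.
Local Notation C := R[i].
Implicit Types (u v : T -> C) (a b : C).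

Definition tends u a := forall e : R, 0 < e -> \forall x \near F, cabs (u x - a) < e.

Lemma tends_cst a : tends (fun=> a) a.
Proof. by move=> e e0; apply: nearW => x; rewrite subrr cabs0. Qed.

Lemma tendsD u v a b : tends u a -> tends v b -> tends (fun x => u x + v x) (a + b).
Proof.
move=> hu hv e e0; have e2 : 0 < e / 2 by rewrite divr_gt0.
apply: filterS2 (hu _ e2) (hv _ e2) => x ux vx.
have -> : u x + v x - (a + b) = (u x - a) + (v x - b) by ring.
by apply: le_lt_trans (cabs_le _ _) _; lra.
Qed.

Lemma tendsM u v a b : tends u a -> tends v b -> tends (fun x => u x * v x) (a * b).
Proof.
move=> hu hv e e0; pose K := 1 + cabs a + cabs b.
have K0 : 0 < K by have := cabs_ge0 a; have := cabs_ge0 b; rewrite /K; lra.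
(* The cap 1 absorbs the product of the two errors; the three error terms then add up to at most K
   times e / (2 K). *)
have eK : 0 < Num.min 1 (e / (2 * K)) by rewrite lt_min ltr01 divr_gt0 ?mulr_gt0.
apply: filterS2 (hu _ eK) (hv _ eK) => x; rewrite !lt_min.
move=> /andP[ux1 ux] /andP[vx1 vx].
have -> : u x * v x - a * b = (u x - a) * b + (u x - a) * (v x - b) + a * (v x - b).
  by ring.
apply: le_lt_trans (cabs_le _ _) _.
apply: le_lt_trans (lerD (cabs_le _ _) (lexx _)) _; rewrite !cabsM.
move: (cabs_ge0 (u x - a)) (cabs_ge0 (v x - b)) (cabs_ge0 a) (cabs_ge0 b).
move: ux1 ux vx1 vx; rewrite ltr_pdivlMr ?mulr_gt0 // ltr_pdivlMr ?mulr_gt0 // /K.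
move: (cabs (u x - a)) (cabs (v x - b)) (cabs a) (cabs b) => p q A B.
by nra.
Qed.

Lemma tends_sum (I : Type) (r : seq I) (u : I -> T -> C) (a : I -> C) :
  (forall i, tends (u i) (a i)) ->
  tends (fun x => \sum_(i <- r) u i x) (\sum_(i <- r) a i).
Proof.
move=> h; elim: r => [|i r IH].
  by move=> e e0; apply: nearW => x; rewrite !big_nil subrr cabs0.
move=> e e0; rewrite big_cons; apply: filterS (tendsD (h i) IH e0) => x.
by rewrite big_cons.
Qed.

(** Convergence is coefficientwise and does not control degrees, so [tends_horner] also asks for a
    uniform degree bound. *)
Definition tendsP (p : T -> {poly C}) (p0 : {poly C}) :=
  forall j, tends (fun x => (p x)`_j) p0`_j.

Lemma tendsP_cst p : tendsP (fun=> p) p. Proof. by move=> j; apply: tends_cst. Qed.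

Lemma tendsPD p q p0 q0 : tendsP p p0 -> tendsP q q0 ->
  tendsP (fun x => p x + q x) (p0 + q0).
Proof.
move=> hp hq j e e0; rewrite coefD; apply: filterS (tendsD (hp j) (hq j) e0) => x.
by rewrite coefD.
Qed.

Lemma tendsPM p q p0 q0 : tendsP p p0 -> tendsP q q0 ->
  tendsP (fun x => p x * q x) (p0 * q0).
Proof.
move=> hp hq j e e0; rewrite coefM.
have h := tends_sum (index_enum 'I_j.+1)
  (fun i : 'I_j.+1 => tendsM (hp i) (hq (j - i)%N)).
by apply: filterS (h _ e0) => x; rewrite coefM.
Qed.

Lemma tendsP_sum (I : Type) (r : seq I) (p : I -> T -> {poly C}) p0 :
  (forall i, tendsP (p i) (p0 i)) ->
  tendsP (fun x => \sum_(i <- r) p i x) (\sum_(i <- r) p0 i).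
Proof.
move=> h; elim: r => [|i r IH] j e e0.
  by apply: nearW => x; rewrite !big_nil subrr cabs0.
rewrite big_cons; apply: filterS (tendsPD (h i) IH j e0) => x.
by rewrite big_cons.
Qed.

Lemma tendsP_prod (I : Type) (r : seq I) (p : I -> T -> {poly C}) p0 :
  (forall i, tendsP (p i) (p0 i)) ->
  tendsP (fun x => \prod_(i <- r) p i x) (\prod_(i <- r) p0 i).
Proof.
move=> h; elim: r => [|i r IH] j e e0.
  by apply: nearW => x; rewrite !big_nil subrr cabs0.
rewrite big_cons; apply: filterS (tendsPM (h i) IH j e0) => x.
by rewrite big_cons.
Qed.

Lemma tendsP_det n (M : T -> 'M[{poly C}]_n) (M0 : 'M[{poly C}]_n) :
  (forall i j, tendsP (fun x => M x i j) (M0 i j)) ->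
  tendsP (fun x => \det (M x)) (\det M0).
Proof.
move=> h; apply: tendsP_sum => s; apply: tendsPM; first exact: tendsP_cst.
exact: tendsP_prod.
Qed.

Lemma tends_horner d (p : T -> {poly C}) (p0 : {poly C}) u a :
  (forall x, size (p x) <= d)%N -> (size p0 <= d)%N ->
  tendsP p p0 -> tends u a -> tends (fun x => (p x).[u x]) p0.[a].
Proof.
move=> sp sp0 hp hu.
have uX i : tends (fun x => u x ^+ i) (a ^+ i).
  elim: i => [|i IH].
    by move=> e e0; apply: nearW => x; rewrite !expr0 subrr cabs0.
  move=> e e0; rewrite exprS; apply: filterS (tendsM hu IH e0) => x.
  by rewrite exprS.
have h := tends_sum (index_enum 'I_d) (fun i : 'I_d => tendsM (hp i) (uX i)).
move=> e e0; rewrite (horner_coef_wide _ sp0); apply: filterS (h _ e0) => x.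
by rewrite (horner_coef_wide _ (sp x)).
Qed.

End Tends.

(** * Persistence of a simple eigenvalue under small perturbations *)

Section Branch.
Variables (R : realType) (n k : nat) (B : coeffs R n k) (l m : R[i] * R[i]).
Local Notation C := R[i].

(** The neighbourhood filter of the zero perturbation for the largest spectral norm of the
    coefficients. *)
Definition small : set_system (coeffs R n k) :=
  [set A | exists2 d : R, 0 < d &
     forall dB, (forall i, spectral_norm (dB i) <= d) -> A dB].

Lemma small_filter : Filter small.
Proof.
split.
- by exists 1.
- move=> P Q [d d0 hP] [e e0 hQ]; exists (Num.min d e); first by rewrite lt_min d0.
  by move=> dB h; split; [apply: hP|apply: hQ] => i; have := h i; rewrite le_min;
    case/andP.
- by move=> P Q PQ [d d0 h]; exists d => // dB hd; apply/PQ/h.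
Qed.

Lemma small_near (P : set (coeffs R n k)) : small P ->
  \forall d \near (0 : R)^'+, forall dB : coeffs R n k,
     (forall i, spectral_norm (dB i) <= d) -> P dB.
Proof.
move=> [d d0 h]; near=> e => dB hdB; apply: h => i; apply: le_trans (hdB i) _.
by near: e; apply: nbhs_right_le.
Unshelve. all: by end_near.
Qed.

Lemma tends_pencil (l' m' : C * C) :
  forall i j, tendsP small (fun dB => pencil (perturb B dB) l' m' i j)
    (pencil B l' m' i j).
Proof.
move=> a b; have FF := small_filter.
have pE B' : pencil B' l' m' a b =
    \sum_(i < k.+1) (lin1 l' m' ^+ i * lin2 l' m' ^+ (k - i)) * (B' i a b)%:P.
  by rewrite /pencil summxE; apply: eq_bigr => i _; rewrite !mxE.
suff h : tendsP small (fun dB : coeffs R n k =>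
    \sum_(i < k.+1) (lin1 l' m' ^+ i * lin2 l' m' ^+ (k - i)) *
      (perturb B dB i a b)%:P) (pencil B l' m' a b).
  by move=> j e e0; apply: filterS (h j e e0) => dB; rewrite -pE.
rewrite pE; apply: tendsP_sum => i; apply: tendsPM; first exact: tendsP_cst.
move=> j e e0; exists (e / 2); first by rewrite divr_gt0.
move=> dB hdB; rewrite !coefC; case: eqP => _; last by rewrite subrr cabs0.
rewrite /perturb mxE [X in X - _]addrC addrK; apply: le_lt_trans (cabs_spectral _ _ _) _.
by apply: le_lt_trans (hdB i) _; lra.
Qed.

(** Moving the base point along the line translates the parameter, so simplicity at the moved point
    can be tested at the root [t] of the original restriction. *)
Lemma on_line_along t p :
  on_line (along l m t) m p = on_line l m p \Po ('X + t%:P).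
Proof.
rewrite /on_line.
have := horner_map (comp_poly ('X + t%:P)) (map_poly (comp_poly (lin2 l m)) p)
  (lin1 l m).
rewrite /= => <-; rewrite -map_poly_comp /=.
have linE (a b : C) : (a + b * t)%:P + b *: 'X = (a%:P + b *: 'X) \Po ('X + t%:P).
  by rewrite comp_polyD comp_polyC comp_polyZ comp_polyX -!mul_polyC polyCD polyCM;
    ring.
have -> : lin1 (along l m t) m = lin1 l m \Po ('X + t%:P) by apply: linE.
have l2E : lin2 (along l m t) m = lin2 l m \Po ('X + t%:P) by apply: linE.
by congr (_.[_]); apply: eq_map_poly => q /=; rewrite l2E -comp_polyA.
Qed.

Lemma size_det_pencil (l' m' : C * C) (B' : coeffs R n k) :
  l'.2 * m'.1 - l'.1 * m'.2 != 0 -> (size (\det (pencil B' l' m')) <= (n * k).+1)%N.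
Proof. by move=> D0; have [phi [s [h _]]] := det_pencil_homog B' D0. Qed.

Hypothesis D0 : l.2 * m.1 - l.1 * m.2 != 0.
Hypotheses (f0 : (\det (pencil B l m))`_0 = 0) (f1 : (\det (pencil B l m))`_1 != 0).

(** The perturbed determinant keeps f_1 away from 0 while f_0 tends to 0, so [small_root] yields a
    root of modulus O(f_0). It is simple because the derivative there is close to its nonzero
    limit. *)
Lemma shifted_branch : exists t : coeffs R n k -> C,
  tends small t 0 /\
  \forall dB \near small, simple_eigenvalue (perturb B dB) (along l m (t dB)).
Proof.
have FF := small_filter.
pose f dB := \det (pencil (perturb B dB) l m).
have tf : tendsP small f (\det (pencil B l m)).
  exact: tendsP_det (tends_pencil l m).
have sf dB : (size (f dB) <= (n * k).+1)%N by apply: size_det_pencil.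
move: f0 f1 tf; set g := \det (pencil B l m) => g0 g1' tf.
have g1 : 0 < cabs g`_1 by rewrite cabs_gt0.
(* Chosen so that the radius r = K |f_0| satisfies the hypothesis of [small_root] as soon as |f_1|
   exceeds |g_1| / 2, the degree being at most n k. *)
pose K : R := 2 * (n * k).+1%:R / cabs g`_1.
have K0 : 0 < K by rewrite divr_gt0 // mulr_gt0.
pose good dB := [set t : C | root (f dB) t /\ cabs t <= K * cabs (f dB)`_0].
pose t dB := xget 0 (good dB).
have good_t : \forall dB \near small, good dB (t dB).
  have h := tf 1%N _ (_ : 0 < cabs g`_1 / 2); apply: filterS (h _); last first.
    by rewrite divr_gt0.
  move=> dB hdB; rewrite /t; apply: xgetPex.
  have f1_big : cabs g`_1 / 2 < cabs (f dB)`_1.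
    have := cabs_le (f dB)`_1 (g`_1 - (f dB)`_1).
    by rewrite addrC subrK [cabs (_ - _)]cabs_distC; lra.
  (* [small_root] needs a positive radius; when the constant coefficient vanishes, 0 itself is the
     root. *)
  have [z|nz] := eqVneq (f dB)`_0 0.
    exists 0; split; last by rewrite cabs0 z cabs0 mulr0.
    by apply/rootP; rewrite horner_coef0.
  have c0 : 0 < cabs (f dB)`_0 by rewrite cabs_gt0.
  have [||s rs sr] := @small_root _ (f dB) (K * cabs (f dB)`_0).
  - by rewrite mulr_gt0.
  - rewrite -mulrA mulrCA mulrC ltr_pM2l //.
    apply: (@le_lt_trans _ _ (n * k).+1%:R).
      by rewrite ler_nat (leq_trans (leq_pred _)).
    apply: (@le_lt_trans _ _ (K * (cabs g`_1 / 2))); last by rewrite ltr_pM2l.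
    by rewrite /K le_eqVlt; apply/orP; left; apply/eqP; field; rewrite gt_eqF.
  - by exists s; split=> //; apply: ltW.
have t_tends : tends small t 0.
  move=> e e0; have h := tf 0%N _ (divr_gt0 e0 K0); apply: filterS2 good_t h.
  move=> dB [_ tb]; rewrite g0 !subr0 ltr_pdivlMr // mulrC => h.
  exact: le_lt_trans tb h.
exists t; split=> //.
have td : tendsP small (fun dB => (f dB)^`()) g^`().
  move=> j e e0; have j0 : 0 < (j.+1%:R : R) by rewrite ltr0n.
  have h := tf j.+1 _ (divr_gt0 e0 j0); apply: filterS h => dB.
  rewrite !coef_deriv -mulrnBl -[X in cabs X < e]mulr_natr cabsM.
  have -> : (j.+1%:R : C) = ((j.+1%:R : R)%:C)%C by rewrite rmorph_nat.
  by rewrite cabs_real ger0_norm ?ler0n // ltr_pdivlMr.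
have lim_d : tends small (fun dB => (f dB)^`().[t dB]) g^`().[0].
  apply: (tends_horner FF (d := (n * k).+1)) td t_tends => [dB|].
    exact: leq_trans (size_deriv_le _) (sf dB).
  by apply: leq_trans (size_deriv_le _) _; apply: size_det_pencil.
have := lim_d _ g1; apply: filterS2 good_t => dB [rt _] hd.
have D0' : (along l m (t dB)).2 * m.1 - (along l m (t dB)).1 * m.2 != 0.
  by rewrite /along /= (_ : _ - _ = l.2 * m.1 - l.1 * m.2) //; ring.
have l0 : along l m (t dB) != (0, 0).
  by apply: contraNneq D0' => ->; rewrite /= !mul0r subrr.
have fE : \det (pencil (perturb B dB) (along l m (t dB)) m) =
    f dB \Po ('X + (t dB)%:P).
  by rewrite /f !det_pencil on_line_along.
apply/(simple_eigenvalueP _ l0 D0'); rewrite fE; split.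
  by rewrite -horner_coef0 horner_comp hornerD hornerX hornerC add0r; apply/rootP.
have -> : (f dB \Po ('X + (t dB)%:P))`_1 = (f dB)^`().[t dB].
  rewrite -[LHS]mulr1n -[_ *+ 1]/(_ *+ (0.+1)) -coef_deriv -horner_coef0.
  rewrite deriv_comp hornerM horner_comp derivD derivC derivX addr0 hornerC mulr1.
  by rewrite hornerD hornerX hornerC add0r.
apply: contraTneq hd => ->; rewrite sub0r cabsN -leNgt.
by rewrite horner_coef0 coef_deriv mulr1n.
Qed.

End Branch.

(** * Taylor expansion of matrix polynomials at 0 *)

Section Expansion.
Variable R : realType.
Local Notation C := R[i].

Definition mxat p q (t : C) (M : 'M[{poly C}]_(p, q)) : 'M[C]_(p, q) :=
  map_mx (horner_eval t) M.

Lemma mxat_expand1 p q t (M : 'M[{poly C}]_(p, q)) :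
  mxat t M = mxcoef 0 M + t *: mxat t (map_mx (drop_poly 1) M).
Proof.
apply/matrixP => i j; rewrite !mxE /horner_eval -[in LHS](poly_take_drop 1 (M i j)).
rewrite hornerD hornerM hornerXn expr1 [_ * t]mulrC; congr (_ + _).
by rewrite /take_poly poly_def big_ord1 !hornerE.
Qed.

Lemma mxat_expand2 p q t (M : 'M[{poly C}]_(p, q)) :
  mxat t M = mxcoef 0 M + t *: mxcoef 1 M + t ^+ 2 *: mxat t (map_mx (drop_poly 2) M).
Proof.
apply/matrixP => i j; rewrite !mxE /horner_eval -[in LHS](poly_take_drop 2 (M i j)).
rewrite hornerD hornerM hornerXn [_ * t ^+ 2]mulrC; congr (_ + _).
by rewrite /take_poly poly_def !big_ord_recl big_ord0 addr0 /= hornerD !hornerZ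
  !hornerXn expr0 mulr1 mulrC.
Qed.

Lemma mxat_bounded p q (M : 'M[{poly C}]_(p, q)) :
  exists2 K, 0 <= K & forall t, cabs t <= 1 -> nrm1 (mxat t M) <= K.
Proof.
exists (\sum_i \sum_j \sum_(h < size (M i j)) cabs (M i j)`_h).
  by do 3![apply: sumr_ge0 => ? _]; apply: cabs_ge0.
move=> t t1; apply: ler_sum => i _; apply: ler_sum => j _.
rewrite mxE /horner_eval horner_coef; apply: le_trans (cabs_sum _ _ _) _.
apply: ler_sum => h _; rewrite cabsM cabsX -[leRHS]mulr1.
by rewrite ler_wpM2l ?cabs_ge0 // exprn_ile1 ?cabs_ge0.
Qed.

End Expansion.

(** * Size of a perturbation along the affine line *)

Section PencilPerturbation.
Variables (R : realType) (n k : nat).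
Local Notation C := R[i].
Implicit Types (B dB : coeffs R n k) (l m : C * C).

Lemma evalmxE B l :
  evalmx (hmxpoly B) l = \sum_(i < k.+1) (l.1 ^+ i * l.2 ^+ (k - i)) *: B i.
Proof.
apply/matrixP => a b; rewrite mxE /hmxpoly !summxE !horner_sum.
apply: eq_bigr => i _; rewrite !mxE !hornerM hornerXn horner_exp !hornerC.
by rewrite horner_exp hornerC horner_exp hornerX.
Qed.

Lemma evalmx_scale B l (c : C) :
  evalmx (hmxpoly B) (c * l.1, c * l.2) = c ^+ k *: evalmx (hmxpoly B) l.
Proof.
rewrite !evalmxE scaler_sumr; apply: eq_bigr => i _ /=; rewrite scalerA; congr (_ *: _).
have -> : c ^+ k = c ^+ i * c ^+ (k - i) by rewrite -exprD subnKC ?leq_ord.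
by rewrite !exprMn; ring.
Qed.

Lemma pencil_perturb B dB l m :
  pencil (perturb B dB) l m = pencil B l m + pencil dB l m.
Proof.
rewrite /pencil -big_split; apply: eq_bigr => i _ /=.
by rewrite -scalerDr -map_mxD.
Qed.

(** The scalar factors, gathered in the row [c], do not depend on the perturbation. Bounds on the
    unit disc for [c] and for its difference quotient at 0 therefore give constants uniform in
    [dB]. *)
Lemma pencil_small l m : exists2 K, 0 <= K & forall dB (d : R) t,
  (forall i, spectral_norm (dB i) <= d) -> cabs t <= 1 ->
  nrm1 (mxat t (pencil dB l m)) <= K * d /\
  nrm1 (mxat t (pencil dB l m) - evalmx (hmxpoly dB) l) <= K * cabs t * d.
Proof.
pose c : 'rV[{poly C}]_k.+1 := \row_i (lin1 l m ^+ i * lin2 l m ^+ (k - i)).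
have [K1 K10 hK1] := mxat_bounded c.
have [K2 K20 hK2] := mxat_bounded (map_mx (drop_poly 1) c).
have nn0 : 0 <= n%:R * n%:R :> R by rewrite mulr_ge0.
exists ((K1 + K2) * (n%:R * n%:R)) => [|dB d t hdB t1].
  by rewrite mulr_ge0 ?addr_ge0.
have d0 : 0 <= d := le_trans (spectral_norm_ge0 _) (hdB ord0).
have atE : mxat t (pencil dB l m) = \sum_i (mxat t c) 0 i *: dB i.
  apply/matrixP => a b; rewrite mxE /pencil !summxE /horner_eval horner_sum.
  by apply: eq_bigr => i _; rewrite !mxE hornerM hornerC.
have at0E : evalmx (hmxpoly dB) l = \sum_i (mxcoef 0 c) 0 i *: dB i.
  rewrite evalmxE; apply: eq_bigr => i _; congr (_ *: _); rewrite !mxE.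
  rewrite -horner_coef0 hornerM !horner_exp /lin1 /lin2 !hornerD !hornerZ !hornerC.
  by rewrite hornerX !mulr0 !addr0.
have comb (u : 'rV[C]_k.+1) :
    nrm1 (\sum_i u 0 i *: dB i) <= nrm1 u * (n%:R * n%:R) * d.
  apply: le_trans (nrm1_sum _ _) _.
  rewrite [X in _ <= X * _ * _]/nrm1 big_ord1 -mulrA mulr_suml.
  apply: ler_sum => i _; rewrite nrm1Z ler_wpM2l ?cabs_ge0 //.
  by apply: le_trans (nrm1_spectral _) _; rewrite ler_wpM2l.
split.
  rewrite atE; apply: le_trans (comb _) _; rewrite ler_wpM2r // ler_wpM2r //.
  by apply: le_trans (hK1 _ t1) _; rewrite lerDl.
have -> : mxat t (pencil dB l m) - evalmx (hmxpoly dB) l =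
    \sum_i (t *: mxat t (map_mx (drop_poly 1) c)) 0 i *: dB i.
  rewrite atE at0E -sumrB; apply: eq_bigr => i _; rewrite -scalerBl; congr (_ *: _).
  by rewrite mxat_expand1 [X in X - _]mxE [X in X - _]addrC addrK.
apply: le_trans (comb _) _; rewrite nrm1Z ler_wpM2r //.
rewrite [leRHS]mulrAC ler_wpM2r // mulrC ler_wpM2r ?cabs_ge0 //.
by apply: le_trans (hK2 _ t1) _; rewrite lerDr.
Qed.

End PencilPerturbation.

(** * Null vectors of a perturbed singular matrix *)

Section NullVector.
Variables (R : realType) (n : nat) (Q : 'M[{poly R[i]}]_n) (x y : 'cV[R[i]]_n).
Local Notation C := R[i].
Hypothesis det1 : (\det Q)`_1 != 0.
Hypotheses (x0 : x != 0) (Q0x : mxcoef 0 Q *m x = 0).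
Hypotheses (y0 : y != 0) (yQ0 : y ^t* *m mxcoef 0 Q = 0).
Local Notation Q0 := (mxcoef 0 Q).

Lemma cdot_self_scalar (v : 'cV[C]_n) :
  v ^t* *m v = ((norm2 v ^+ 2)%:C)%C%:M.
Proof. by rewrite [LHS]mx11_scalar cdot_self. Qed.

Lemma norm2_sqrC_neq0 (v : 'cV[C]_n) : v != 0 -> ((norm2 v ^+ 2)%:C)%C != 0 :> C.
Proof.
move=> v0; rewrite -cabs_eq0 cabs_real normr_eq0 expf_neq0 // gt_eqF //.
exact: norm2_gt0.
Qed.

(** On a kernel element Z, multiplying by the adjoint of [y] kills Q0 and forces Z to be orthogonal
    to [x]; then Q0 Z = 0, so Z is a multiple of [x], hence 0. *)
Lemma bordered_unit : Q0 + y *m x ^t* \in unitmx.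
Proof.
rewrite -unitmx_tr -row_free_unit -kermx_eq0; set K := kermx _.
pose Z := K^T.
have MZ : (Q0 + y *m x ^t*) *m Z = 0.
  by rewrite -[LHS]trmxK trmx_mul trmxK mulmx_ker trmx0.
have xZ : x ^t* *m Z = 0.
  have := congr1 (mulmx (y ^t*)) MZ; rewrite mulmx0 mulmxA mulmxDr yQ0 add0r mulmxA.
  rewrite cdot_self_scalar mul_scalar_mx -scalemxAl => /eqP.
  by rewrite scaler_eq0 (negPf (norm2_sqrC_neq0 y0)) => /eqP.
have Q0Z : Q0 *m Z = 0 by move: MZ; rewrite mulmxDl -mulmxA xZ mulmx0 addr0.
have [a ZE] := kernel_spanned det1 x0 Q0x Q0Z.
move: xZ; rewrite ZE mulmxA cdot_self_scalar mul_scalar_mx => /eqP.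
rewrite scaler_eq0 (negPf (norm2_sqrC_neq0 x0)) /= => /eqP a0.
by rewrite -trmx_eq0 -/Z ZE a0 mulmx0.
Qed.

Lemma null_vector_close : exists2 K : R, 0 < K & forall (D : 'M[C]_n) (z : 'cV[C]_n),
  z != 0 -> (Q0 + D) *m z = 0 -> K * nrm1 D <= 1 ->
  exists z', [/\ (Q0 + D) *m z' = 0, nrm1 (x - z') <= K * nrm1 D & nrm1 z' <= K].
Proof.
pose M := Q0 + y *m x ^t*; pose G := nrm1 (invmx M); pose X := nrm1 x.
have G0 : 0 <= G by apply: nrm1_ge0.
have X0 : 0 <= X by apply: nrm1_ge0.
(* The first term keeps [G * nrm1 D] below 1/2 and covers the distance bound 2 G X [nrm1 D]; the
   second bounds [nrm1 z']; the last gives positivity. *)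
exists (2 * G * (1 + X) + 2 * X + 1) => [|D z z0 hz KD].
  by rewrite ltr_wpDl // addr_ge0 ?mulr_ge0 ?addr_ge0.
have D0 := nrm1_ge0 D.
have solve (v w : 'cV[C]_n) : M *m v = w -> nrm1 v <= G * nrm1 w.
  by move=> <-; rewrite -[v in leLHS](mulKmx bordered_unit) nrm1M.
have GD : G * nrm1 D <= 1 / 2 by nra.
have MzE (v : 'cV[C]_n) : (Q0 + D) *m v = 0 ->
    M *m v = (x ^t* *m v) 0 0 *: y - D *m v.
  move=> h; have vE : Q0 *m v = - (D *m v).
    by apply/eqP; rewrite -addr_eq0 -mulmxDl h.
  by rewrite /M mulmxDl -mulmxA vE {1}[x ^t* *m v]mx11_scalar mul_mx_scalar addrC.
(* Otherwise M z = - D z, and inverting M gives [nrm1 z] at most half of itself. *)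
have s0 : (x ^t* *m z) 0 0 != 0.
  apply/eqP => s0; have := solve _ _ (MzE _ hz); rewrite s0 scale0r sub0r nrm1N => h.
  have zz := nrm1_gt0 z0; have := nrm1M D z; move: h GD zz D0 G0.
  move: (nrm1 (D *m z)) (nrm1 D) (nrm1 z) => p d s; nra.
(* This scaling gives [z'] the same inner product with [x] as [x] itself, so the multiples of [y]
   cancel in M (x - z'). *)
pose z' := (((norm2 x ^+ 2)%:C)%C / (x ^t* *m z) 0 0) *: z.
have hz' : (Q0 + D) *m z' = 0 by rewrite /z' -scalemxAr hz scaler0.
have xz' : (x ^t* *m z') 0 0 = ((norm2 x ^+ 2)%:C)%C.
  by rewrite /z' -scalemxAr mxE divfK.
have diff : nrm1 (x - z') <= G * (nrm1 D * nrm1 z').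
  have : M *m (x - z') = D *m z'.
    rewrite mulmxBr (MzE _ hz') xz' /M mulmxDl Q0x add0r -mulmxA cdot_self_scalar.
    by rewrite mul_mx_scalar opprB addrC subrK.
  move=> /solve h; apply: le_trans h _; rewrite ler_wpM2l //; exact: nrm1M.
have z'X : nrm1 z' <= 2 * X.
  have : nrm1 z' <= X + nrm1 (x - z').
    have := nrm1D x (- (x - z')); rewrite nrm1N.
    by rewrite [w in nrm1 w <= _](_ : _ = z') // opprB addrC subrK.
  have := nrm1_ge0 z'; move: diff GD; rewrite mulrA.
  move: (nrm1 (x - z')) (G * nrm1 D) (nrm1 z') => p d s; nra.
have z'0 := nrm1_ge0 z'.
exists z'; split=> //; last by nra.
apply: le_trans diff _; rewrite mulrA.
move: z'X z'0; move: (nrm1 z') => s sX s0'.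
apply: (@le_trans _ _ (G * nrm1 D * (2 * X))); first by rewrite ler_wpM2l ?mulr_ge0.
have GD0 : 0 <= G * nrm1 D by rewrite mulr_ge0.
have XD0 : 0 <= X * nrm1 D by rewrite mulr_ge0.
nra.
Qed.

End NullVector.

(** * First-order relation between eigenvalue shift and perturbation *)

Section FirstOrder.
Variables (R : realType) (n k : nat) (B : coeffs R n k) (l m : R[i] * R[i]).
Variables (x y : 'cV[R[i]]_n).
Local Notation C := R[i].
Local Notation Q := (pencil B l m).
Hypothesis det1 : (\det Q)`_1 != 0.
Hypotheses (x0 : x != 0) (Q0x : mxcoef 0 Q *m x = 0).
Hypotheses (y0 : y != 0) (yQ0 : y ^t* *m mxcoef 0 Q = 0).

Definition pairing (A : 'M[C]_n) : C := (y ^t* *m A *m x) 0 0.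

Lemma first_order : exists2 K : R, 0 < K &
  forall (dB : coeffs R n k) (d : R) t (z : 'cV[C]_n),
  (forall i, spectral_norm (dB i) <= d) -> cabs t <= 1 -> K * (cabs t + d) <= 1 ->
  z != 0 -> evalmx (hmxpoly (perturb B dB)) (along l m t) *m z = 0 ->
  cabs (t * pairing (mxcoef 1 Q) + pairing (evalmx (hmxpoly dB) l))
    <= K * (cabs t + d) ^+ 2.
Proof.
have [N N0 hN] := null_vector_close det1 x0 Q0x y0 yQ0.
have [P P0 hP] := pencil_small n k l m.
have [M M0 hM] := mxat_bounded (map_mx (drop_poly 2) Q).
(* [L] bounds the perturbation [D] below by L (|t| + d); the added 1 allows L <= L^2. *)
pose L := nrm1 (mxcoef 1 Q) + M + P + 1; pose Y := nrm1 (y ^t*).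
have q0 : 0 <= nrm1 (mxcoef 1 Q) := nrm1_ge0 _.
have Y0 : 0 <= Y := nrm1_ge0 _.
have L1 : 1 <= L by rewrite /L; lra.
have L0 : 0 <= L := le_trans ler01 L1.
have NW := ltW N0.
have NL : 0 < N * L by rewrite mulr_gt0 // (lt_le_trans ltr01).
have YNL : 0 <= 2 * Y * N * L ^+ 2 by rewrite !mulr_ge0.
(* The first term secures the smallness needed by [null_vector_close]; the second collects two
   errors of size Y N L^2 (|t| + d)^2. *)
exists (N * L + 2 * Y * N * L ^+ 2) => [|dB d t z hdB t1 small_td z0 hz].
  by lra.
have d0 : 0 <= d := le_trans (spectral_norm_ge0 _) (hdB ord0).
have t0 := cabs_ge0 t.
pose E0 := evalmx (hmxpoly dB) l; pose Et := mxat t (pencil dB l m).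
pose T := mxat t (map_mx (drop_poly 2) Q).
have [hEt hE] := hP dB d t hdB t1; rewrite -/Et -/E0 in hEt hE.
have hT : nrm1 T <= M := hM t t1.
pose D := t *: mxcoef 1 Q + (t ^+ 2 *: T + Et).
have QE : evalmx (hmxpoly (perturb B dB)) (along l m t) = mxcoef 0 Q + D.
  rewrite -pencil_horner -/(mxat t _) pencil_perturb /D addrA.
  have -> : mxat t (Q + pencil dB l m) = mxat t Q + Et.
    by apply/matrixP => a b; rewrite !mxE /horner_eval hornerD.
  by rewrite (mxat_expand2 t Q) -/T !addrA.
have tt : cabs t ^+ 2 <= cabs t by rewrite expr2 -[leRHS]mulr1 ler_wpM2l.
have D_le : nrm1 D <= L * (cabs t + d).
  apply: le_trans (nrm1D _ _) _; rewrite nrm1Z.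
  apply: le_trans (lerD (lexx _) (nrm1D _ _)) _; rewrite nrm1Z cabsX.
  have h1 : cabs t ^+ 2 * nrm1 T <= cabs t * M by rewrite ler_pM ?sqr_ge0 ?nrm1_ge0.
  rewrite /L; move: q0 hEt h1; move: (nrm1 (mxcoef 1 Q)) (nrm1 Et) => q e.
  by move: (cabs t ^+ 2 * nrm1 T) => p; nra.
have [||z' [hz' dz nz]] := hN D z z0.
- by rewrite -QE.
- apply: le_trans (ler_wpM2l (ltW N0) D_le) _; rewrite mulrA.
  by apply: le_trans small_td; rewrite ler_wpM2r ?addr_ge0 // lerDl.
have yD : y ^t* *m D *m z' = 0.
  have := congr1 (mulmx (y ^t*)) hz'.
  by rewrite mulmx0 mulmxA mulmxDr yQ0 add0r.
(* Split D into its first-order part and a remainder. As [yD] kills their sum at [z'], replacing [x]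
   by [z'] costs a product of two first-order terms plus the remainder, all of second order. *)
have -> : t * pairing (mxcoef 1 Q) + pairing E0 =
    (y ^t* *m ((t *: mxcoef 1 Q + E0) *m (x - z') -
               (t ^+ 2 *: T + (Et - E0)) *m z')) 0 0.
  rewrite mulmxBr !mulmxA.
  have -> : y ^t* *m (t ^+ 2 *: T + (Et - E0)) *m z' =
      - (y ^t* *m (t *: mxcoef 1 Q + E0) *m z').
    apply/eqP; rewrite -addr_eq0 -mulmxDl -mulmxDr.
    have -> : t ^+ 2 *: T + (Et - E0) + (t *: mxcoef 1 Q + E0) = D.
      have gen (a b c e : 'M[C]_n) : a + (b - e) + (c + e) = c + (a + b).
        by apply/matrixP => i j; rewrite !mxE; ring.
      exact: gen.
    by rewrite yD.
  rewrite opprK mulmxBr subrK mulmxDr mulmxDl -scalemxAr -scalemxAl.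
  by rewrite [RHS]mxE [X in _ = X + _]mxE.
apply: le_trans (cabs_nrm1 _ _ _) _; apply: le_trans (nrm1M _ _) _; rewrite -/Y.
set S := cabs t + d.
have S0 : 0 <= S by rewrite addr_ge0.
have b1 : nrm1 ((t *: mxcoef 1 Q + E0) *m (x - z')) <= L * S * (N * (L * S)).
  apply: le_trans (nrm1M _ _) _; apply: ler_pM; rewrite ?nrm1_ge0 //; last first.
    by apply: le_trans dz _; rewrite ler_wpM2l // ltW.
  have E0_le : nrm1 E0 <= P * d.
    have z1 : cabs (0 : C) <= 1 by rewrite cabs0.
    have [h1 h2] := hP dB d 0 hdB z1.
    have := nrm1D (mxat 0 (pencil dB l m)) (- (mxat 0 (pencil dB l m) - E0)).
    rewrite nrm1N opprB addrC subrK.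
    by move: h2; rewrite cabs0 mulr0 mul0r -/E0; lra.
  apply: le_trans (nrm1D _ _) _; rewrite nrm1Z /L /S.
  by move: q0 E0_le; move: (nrm1 (mxcoef 1 Q)) (nrm1 E0) => q e; nra.
have b2 : nrm1 ((t ^+ 2 *: T + (Et - E0)) *m z') <= L * S ^+ 2 * N.
  apply: le_trans (nrm1M _ _) _; apply: ler_pM; rewrite ?nrm1_ge0 //.
  apply: le_trans (nrm1D _ _) _; rewrite nrm1Z cabsX /L /S.
  have h1 : cabs t ^+ 2 * nrm1 T <= cabs t ^+ 2 * M by rewrite ler_wpM2l ?sqr_ge0.
  have h2 : P * cabs t * d <= P * (cabs t + d) ^+ 2.
    by rewrite -mulrA ler_wpM2l //; nra.
  have h3 : cabs t ^+ 2 * M <= M * (cabs t + d) ^+ 2.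
    by rewrite mulrC ler_wpM2l // lerXn2r ?nnegrE ?addr_ge0 // lerDl.
  have h4 : 0 <= (nrm1 (mxcoef 1 Q) + 1) * (cabs t + d) ^+ 2.
    by rewrite mulr_ge0 ?addr_ge0 ?sqr_ge0.
  by lra.
have b3 : L * S ^+ 2 * N <= N * L ^+ 2 * S ^+ 2.
  have -> : L * S ^+ 2 * N = N * S ^+ 2 * L by ring.
  have -> : N * L ^+ 2 * S ^+ 2 = N * S ^+ 2 * L ^+ 2 by ring.
  rewrite ler_wpM2l ?mulr_ge0 ?sqr_ge0 ?(ltW N0) // expr2.
  by rewrite -[leLHS]mulr1 ler_wpM2l // (le_trans ler01).
have := nrm1D ((t *: mxcoef 1 Q + E0) *m (x - z'))
  (- ((t ^+ 2 *: T + (Et - E0)) *m z')).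
rewrite nrm1N => h.
have {}h : nrm1 ((t *: mxcoef 1 Q + E0) *m (x - z') -
    (t ^+ 2 *: T + (Et - E0)) *m z') <= 2 * (N * L ^+ 2 * S ^+ 2).
  apply: le_trans h _; apply: le_trans (lerD b1 (le_trans b2 b3)) _.
  by rewrite le_eqVlt; apply/orP; left; apply/eqP; ring.
apply: le_trans (ler_wpM2l Y0 h) _.
have : 0 <= N * L * S ^+ 2 by rewrite mulr_ge0 ?sqr_ge0 // ltW.
by lra.
Qed.

End FirstOrder.

(** * Real inequalities passing from the first-order estimate to quotients *)

Section Squeeze.
Variable R : realType.

(** Here t stands for the modulus of the shift, c for the chordal distance, a for the modulus of the
    paired perturbation and e for its size. *)
Lemma quotient_squeeze (q kap K W eta : R) :
  0 < q -> 0 <= kap -> 0 < K -> 0 < W -> 0 < eta ->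
  exists2 rho, 0 < rho & forall e t c a : R,
    0 < e -> e * W <= rho -> 0 <= t -> t <= rho -> c <= t -> t <= c * (1 + t) ->
    `|t * q - a| <= K * (t + e * W) ^+ 2 ->
    (a <= e * (kap * q) -> c / e <= kap + eta) /\
    (a = e * (kap * q) -> kap - eta <= c / e).
Proof.
move=> q0 kap0 K0 W0 eta0.
(* Losses per unit of rho: [d1] in the upper bound, [d2] in the lower one; each must stay below the
   slack eta q. *)
pose d1 := 2 * K * (W + kap + eta); pose d2 := 4 * K * kap + q * kap + 2 * K * W.
have d10 : 0 < d1 by rewrite /d1 !mulr_gt0 //; lra.
have KW : 0 < K * W by rewrite mulr_gt0.
have Kk : 0 <= K * kap by rewrite mulr_ge0 // ltW.
have qk : 0 <= q * kap by rewrite mulr_ge0 // ltW.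
have d20 : 0 < d2 by rewrite /d2; lra.
have eq0 : 0 < eta * q by rewrite mulr_gt0.
exists (Num.min 1 (Num.min (eta * q / d1) (eta * q / d2))).
  by rewrite !lt_min ltr01 !divr_gt0.
set rho := Num.min _ _ => e t c a e0 eW t0 trho ct tc h.
have rho0 : 0 < rho by rewrite /rho !lt_min ltr01 !divr_gt0.
have [r1 r2 r3] : [/\ rho <= 1, rho * d1 <= eta * q & rho * d2 <= eta * q].
  split; first by rewrite /rho ge_min lexx.
    by rewrite -ler_pdivlMr // /rho !ge_min lexx orbT.
  by rewrite -ler_pdivlMr // /rho !ge_min lexx !orbT.
clearbody rho.
have eW0 : 0 < e * W by rewrite mulr_gt0.
(* One of the two factors t + e W is at most 2 rho, which makes the error linear in t and e. *)
have h2 : K * (t + e * W) ^+ 2 <= 2 * K * rho * t + e * (2 * K * W * rho).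
  have -> : 2 * K * rho * t + e * (2 * K * W * rho) = K * ((t + e * W) * (2 * rho)).
    by ring.
  rewrite ler_pM2l // expr2 ler_wpM2l //; lra.
move: h; rewrite ler_norml => /andP[h3 h4].
have Krho : 0 < K * rho by rewrite mulr_gt0.
split=> ha.
  rewrite ler_pdivrMr //; apply: le_trans ct _.
  have den : 0 < q - 2 * K * rho.
    have : 2 * K * rho * (W + kap + eta) <= eta * q by move: r2; rewrite /d1; lra.
    have : eta * q < (W + kap + eta) * q by rewrite ltr_pM2r //; lra.
    have D0 : 0 < W + kap + eta by lra.
    move=> u v; have := le_lt_trans v u; rewrite [ltRHS]mulrC ltr_pM2r //; lra.
  rewrite -(ler_pM2r den).
  apply: (@le_trans _ _ (e * (kap * q + 2 * K * W * rho))); first by lra.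
  rewrite (_ : _ * e * _ = e * ((kap + eta) * (q - 2 * K * rho))); last by ring.
  rewrite ler_pM2l //.
  by move: r2; rewrite /d1; lra.
have c0 : 0 <= c.
  by rewrite -(@pmulr_lge0 _ (1 + t)) ?(le_trans t0) //; lra.
(* For kap <= eta the lower bound is nonpositive; otherwise kap - eta is positive and may multiply
   inequalities. *)
have [small|big] := leP kap eta.
  by apply: le_trans (divr_ge0 c0 (ltW e0)); lra.
rewrite ler_pdivlMr //.
have q2 : 0 < q + 2 * K * rho by lra.
have c1 : t <= c * (1 + rho).
  by apply: le_trans tc _; rewrite ler_wpM2l //; lra.
have pos : 0 < (q + 2 * K * rho) * (1 + rho) by rewrite mulr_gt0 //; lra.
rewrite -(ler_pM2r pos).
apply: (@le_trans _ _ (e * (kap * q - 2 * K * W * rho))); last first.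
  apply: (@le_trans _ _ (t * (q + 2 * K * rho))); first by lra.
  by rewrite [X in _ <= c * X]mulrC mulrA ler_pM2r.
rewrite (_ : (kap - eta) * e * _ =
  e * ((kap - eta) * ((q + 2 * K * rho) * (1 + rho)))); last by ring.
rewrite ler_pM2l //.
apply: (@le_trans _ _ ((kap - eta) * q + kap * (4 * K * rho + q * rho))).
  rewrite (_ : (kap - eta) * _ = (kap - eta) * q +
    (kap - eta) * (2 * K * rho + q * rho + 2 * K * rho * rho)); last by ring.
  rewrite lerD2l.
  have kr : K * rho * rho <= K * rho by rewrite -[leRHS]mulr1 ler_pM2l.
  have qr : 0 < q * rho by rewrite mulr_gt0.
  have Krr : 0 < K * rho * rho by rewrite mulr_gt0.
  by apply: ler_pM; lra.
by move: r3; rewrite /d2; lra.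
Qed.

End Squeeze.

Lemma near_right_ex (R : realType) (P : R -> Prop) :
  (\forall d \near (0 : R)^'+, P d) -> exists2 d, 0 < d & P d.
Proof.
move=> h; have [d [d0 Pd]] := filter_ex (filterI (nbhs_right_gt (0 : R)) h).
by exists d.
Qed.

Lemma det_evalmx (R : realType) n (P : 'M[{poly {poly R[i]}}]_n) (l : R[i] * R[i]) :
  \det (evalmx P l) = (\det P).[l.1, l.2].
Proof.
rewrite /evalmx.
have := det_map_mx (horner_eval l.2 \o horner_eval l.1%:P) P.
by rewrite /= /horner_eval => <-.
Qed.

(** * Closed form of the Stewart-Sun condition number *)

Section StewartSun.
Variables (R : realType) (n k : nat) (B : coeffs R n k) (l : R[i] * R[i]).
Variables (w : 'I_k.+1 -> R) (x y : 'cV[R[i]]_n).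
Local Notation C := R[i].
Local Notation m := (normal_dir l).
Local Notation Q := (pencil B l m).
Hypotheses (simple : simple_eigenvalue B l) (w0 : forall i, 0 <= w i).
Hypotheses (rx : right_eigenvector B l x) (ly : left_eigenvector B l y).

Lemma l_neq0 : l != (0, 0). Proof. by case: simple => [[]]. Qed.

Lemma normal_dir_det : l.2 * m.1 - l.1 * m.2 != 0.
Proof.
rewrite /normal_dir /= mulrN opprK !mul_conj -rmorphD addrC -col2_norm.
by rewrite -cabs_eq0 cabs_real normr_eq0 expf_neq0 // gt_eqF // col2_gt0 // l_neq0.
Qed.

Lemma det_coefs : (\det Q)`_0 = 0 /\ (\det Q)`_1 != 0.
Proof. exact/(simple_eigenvalueP B l_neq0 normal_dir_det). Qed.

Let det0 := proj1 det_coefs.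
Let det1 := proj2 det_coefs.

Let Q0x : mxcoef 0 Q *m x = 0. Proof. by rewrite pencil_coef0; case: rx. Qed.
Let yQ0 : y ^t* *m mxcoef 0 Q = 0. Proof. by rewrite pencil_coef0; case: ly. Qed.
Let x_neq0 : x != 0. Proof. by case: rx. Qed.
Let y_neq0 : y != 0. Proof. by case: ly. Qed.
Let x_gt0 : 0 < norm2 x. Proof. exact: norm2_gt0. Qed.
Let y_gt0 : 0 < norm2 y. Proof. exact: norm2_gt0. Qed.

Local Notation q := (pairing x y (mxcoef 1 Q)).

Lemma pairing_neq0 : q != 0.
Proof.
apply: (simple_root_pairing det0 det1 x_neq0 Q0x _ yQ0).
apply: contra y_neq0 => /eqP y0; apply/eqP/matrixP => i j.
have := congr1 (fun A : 'rV[C]_n => A 0 i) y0.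
by rewrite !mxE ord1 => /eqP; rewrite conjC_eq0 => /eqP.
Qed.

(** [shifted_branch] provides a branch, so [xget] returns a genuine one instead of its default
    value. *)
Lemma perturbed_eigenvalueP : eigenvalue_branch B l (perturbed_eigenvalue B l).
Proof.
have FF := small_filter R n k.
apply: xgetPex.
have [t [t0 ts]] := shifted_branch normal_dir_det det0 det1.
exists (fun dB => along l m (t dB)); split; first exact: small_near.
move=> e e0; apply: small_near; apply: filterS (t0 e e0) => dB; rewrite subr0.
by apply: le_lt_trans; case/andP: (chordal_along_le (t dB) l_neq0).
Qed.

(** The candidate value of [kappa_theta]. Its denominator is that of [kappa_h], since the
    coefficient paired here is the derivative of P in the normal direction. *)
Definition theta_value : R :=
  (\sum_(i < k.+1) cabs l.1 ^+ i * cabs l.2 ^+ (k - i) * w i) *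
  (norm2 y * norm2 x) / cabs q.

Lemma theta_valueK : theta_value * cabs q =
  (\sum_(i < k.+1) cabs l.1 ^+ i * cabs l.2 ^+ (k - i) * w i) *
  (norm2 y * norm2 x).
Proof. by rewrite /theta_value divfK // cabs_eq0 pairing_neq0. Qed.

Lemma theta_value_ge0 : 0 <= theta_value.
Proof.
rewrite /theta_value divr_ge0 ?cabs_ge0 // mulr_ge0 ?mulr_ge0 ?norm2_ge0 //.
by apply: sumr_ge0 => i _; rewrite !mulr_ge0 ?exprn_ge0 ?cabs_ge0.
Qed.

Lemma pairingE dB : pairing x y (evalmx (hmxpoly dB) l) =
  \sum_(i < k.+1) l.1 ^+ i * l.2 ^+ (k - i) * pairing x y (dB i).
Proof.
rewrite /pairing evalmxE mulmx_sumr mulmx_suml summxE; apply: eq_bigr => i _.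
by rewrite -scalemxAr -scalemxAl mxE.
Qed.

Lemma pairing_le (dB : coeffs R n k) (e : R) :
  (forall i, spectral_norm (dB i) <= e * w i) ->
  cabs (pairing x y (evalmx (hmxpoly dB) l)) <= e * (theta_value * cabs q).
Proof.
move=> hdB; rewrite theta_valueK pairingE; apply: le_trans (cabs_sum _ _ _) _.
rewrite mulr_suml mulr_sumr; apply: ler_sum => i _.
rewrite !cabsM !cabsX [leRHS](_ : _ = cabs l.1 ^+ i * cabs l.2 ^+ (k - i) *
  (norm2 y * (e * w i * norm2 x))); last by ring.
rewrite ler_wpM2l ?mulr_ge0 ?exprn_ge0 ?cabs_ge0 // /pairing -mulmxA.
apply: le_trans (cdot_le _ _) _; rewrite ler_wpM2l ?norm2_ge0 //.
by apply: le_trans (norm2_mul _ _) _; rewrite ler_wpM2r ?norm2_ge0.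
Qed.

(* The phases a^* / |a| are 0 when a = 0, since 0^-1 = 0. *)
Definition worst_perturbation (e : R) : coeffs R n k := fun i =>
  let a := l.1 ^+ i * l.2 ^+ (k - i) in
  ((e * w i / (norm2 y * norm2 x))%:C%C * (a^* / (cabs a)%:C%C)) *: (y *m x ^t*).

Lemma worst_perturbation_norm e i : 0 <= e ->
  spectral_norm (worst_perturbation e i) <= e * w i.
Proof.
move=> e0; apply: le_trans (spectral_norm_rank1 _ _ _) _.
set a := l.1 ^+ i * _; have N0 : 0 < norm2 y * norm2 x by rewrite mulr_gt0.
have ew : 0 <= e * w i by rewrite mulr_ge0.
rewrite cabsM cabs_real ger0_norm ?divr_ge0 // ?(ltW N0) //.
rewrite mulrAC divfK ?gt_eqF // -[leRHS]mulr1 ler_wpM2l //.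
rewrite cabsM cabsV cabs_conj cabs_real ger0_norm ?cabs_ge0 //.
have [->|a0] := eqVneq (cabs a) 0; first by rewrite mul0r.
by rewrite divff.
Qed.

(** The phases turn every term of the pairing into a nonnegative real, so the triangle inequality
    behind [pairing_le] becomes an equality. *)
Lemma worst_perturbation_pairing e : 0 <= e ->
  cabs (pairing x y (evalmx (hmxpoly (worst_perturbation e)) l)) =
    e * (theta_value * cabs q).
Proof.
move=> e0; have N0 : 0 < norm2 y * norm2 x by rewrite mulr_gt0.
rewrite -[RHS]ger0_norm; last first.
  by rewrite mulr_ge0 // mulr_ge0 ?theta_value_ge0 ?cabs_ge0.
rewrite -cabs_real; congr cabs; rewrite theta_valueK pairingE.
rewrite mulr_suml mulr_sumr rmorph_sum; apply: eq_bigr => i _.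
rewrite /worst_perturbation; set a := l.1 ^+ i * _.
have -> : cabs l.1 ^+ i * cabs l.2 ^+ (k - i) = cabs a.
  by rewrite /a cabsM !cabsX.
rewrite /pairing -scalemxAr -scalemxAl mxE !mulmxA cdot_self_scalar.
rewrite mul_scalar_mx -scalemxAl cdot_self_scalar [in LHS]mxE [_%:M 0 0]mxE mulr1n.
have phase : a * (a^* / (cabs a)%:C%C) = (cabs a)%:C%C.
  have [->|a0] := eqVneq a 0; first by rewrite cabs0 mul0r.
  rewrite mulrA mul_conj expr2 rmorphM /= mulfK //.
  by rewrite -cabs_eq0 cabs_real normr_eq0 cabs_eq0.
rewrite [LHS]mulrA [a * _]mulrCA phase -!rmorphM; congr (_%:C%C).
by field; rewrite !gt_eqF.
Qed.

(** One threshold serves all admissible perturbations, as a supremum over them requires. *)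
Lemma theta_squeeze (eta : R) : 0 < eta -> exists2 e0 : R, 0 < e0 &
  forall (e : R) (dB : coeffs R n k), 0 < e -> e < e0 ->
  (forall i, spectral_norm (dB i) <= e * w i) ->
  let mu := perturbed_eigenvalue B l dB in
  let a := cabs (pairing x y (evalmx (hmxpoly dB) l)) in
  [/\ exists z, right_eigenvector (perturb B dB) mu z,
      a <= e * (theta_value * cabs q) -> chordal l mu / e <= theta_value + eta &
      a = e * (theta_value * cabs q) -> theta_value - eta <= chordal l mu / e].
Proof.
move=> eta0.
have [K K0 hK] := first_order det1 x_neq0 Q0x y_neq0 yQ0.
pose W : R := 1 + \sum_i w i.
have W0 : 0 < W by rewrite /W ltr_pwDl // sumr_ge0.
have wW i : w i <= W.
  rewrite /W (bigD1 i) //= addrCA lerDl addr_ge0 // sumr_ge0 //.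
have q_gt0 : 0 < cabs q by rewrite cabs_gt0 pairing_neq0.
have [rho rho0 hrho] := quotient_squeeze q_gt0 theta_value_ge0 K0 W0 eta0.
(* The three caps serve [quotient_squeeze], the unit disc, and the condition K (|t| + e W) <= 1 of
   [first_order]. *)
pose r1 := Num.min rho (Num.min 1 (2 * K)^-1).
have r10 : 0 < r1 by rewrite /r1 !lt_min rho0 ltr01 invr_gt0 mulr_gt0.
have [r1rho r11 r1K] : [/\ r1 <= rho, r1 <= 1 & 2 * K * r1 <= 1].
  split; first by rewrite /r1 ge_min lexx.
    by rewrite /r1 !ge_min lexx orbT.
  rewrite mulrC -ler_pdivlMr ?mulr_gt0 // div1r.
  by rewrite /r1 !ge_min lexx !orbT.
clearbody r1.
have [mu_simple mu_close] := perturbed_eigenvalueP.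
have [d1 d10 hd1] := near_right_ex mu_simple.
have [|d2 d20 hd2] := near_right_ex (mu_close (r1 / 2) _); first by rewrite divr_gt0.
exists (Num.min r1 (Num.min d1 d2) / W) => [|e dB e0 ee hdB mu a].
  by rewrite divr_gt0 // !lt_min r10 d10.
move: ee; rewrite ltr_pdivlMr // !lt_min => /andP[/ltW er1 /andP[/ltW ed1 /ltW ed2]].
have dB_W i : spectral_norm (dB i) <= e * W.
  by apply: le_trans (hdB i) _; rewrite ler_pM2l.
have sm : simple_eigenvalue (perturb B dB) mu.
  by apply: hd1 => i; apply: le_trans (dB_W i) ed1.
have cm : chordal l mu < r1 / 2 by apply: hd2 => i; apply: le_trans (dB_W i) ed2.
have mu0 : mu != (0, 0) by case: sm => [[]].
have [z z0 hz] : exists2 z : 'cV[C]_n, z != 0 &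
    evalmx (hmxpoly (perturb B dB)) mu *m z = 0.
  have : \det (evalmx (hmxpoly (perturb B dB)) mu)^T == 0.
    by rewrite det_tr det_evalmx; case: sm => [[_ ->]].
  case/det0P => v v0 hv; exists v^T; first by rewrite trmx_eq0.
  by rewrite -[LHS]trmxK trmx_mul trmxK hv trmx0.
have [|c [t [c0 muE]]] := chordal_lt1_along l_neq0 mu0.
  by apply: lt_le_trans cm _; lra.
have az : evalmx (hmxpoly (perturb B dB)) (along l m t) *m z = 0.
  move: hz; rewrite muE evalmx_scale -scalemxAl => /eqP.
  by rewrite scaler_eq0 expf_eq0 (negPf c0) andbF => /eqP.
have cE : chordal l mu = chordal l (along l m t).
  by rewrite muE chordal_scale ?l_neq0 // along_neq0 // l_neq0.
have t0 := cabs_ge0 t.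
have /andP[] := chordal_along_le t l_neq0; rewrite -cE.
have t1 : 0 < 1 + cabs t by lra.
rewrite ler_pdivrMr // => tc ct.
(* From |t| <= chi (1 + |t|) with chi < r1 / 2 and r1 <= 1, the term in |t| on the right is absorbed
   into the left; this is why half of r1 was asked for. *)
have tr : cabs t <= r1.
  have : cabs t < r1 / 2 * (1 + cabs t).
    by apply: le_lt_trans tc _; rewrite ltr_pM2r.
  have : r1 / 2 * cabs t <= cabs t / 2.
    by rewrite [leLHS]mulrAC ler_wpM2r // -[leRHS]mul1r ler_wpM2r.
  by rewrite mulrDr mulr1; lra.
have fo := hK dB (e * W) t z dB_W (le_trans tr r11) _ z0 az.
have {}fo : `|cabs t * cabs q - a| <= K * (cabs t + e * W) ^+ 2.
  apply: le_trans (fo _); first by rewrite -cabsM; apply: cabs_dist_le.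
  apply: (@le_trans _ _ (K * (r1 + r1))); first by rewrite ler_pM2l // lerD.
  by lra.
have [up low] := hrho e (cabs t) (chordal l mu) a e0 (le_trans er1 r1rho) t0
  (le_trans tr r1rho) ct tc fo.
by split=> //; exists z.
Qed.

(** For small e every quotient is at most [theta_value + eta], and the extremal perturbation gives
    one that is at least [theta_value - eta]; the supremum lies in between. *)
Lemma kappa_thetaE : kappa_theta w B l = theta_value.
Proof.
apply/cvg_lim => //; apply/cvgrPdist_le => eta eta0.
have [e0 e00 he] := theta_squeeze eta0.
near=> e.
have e_gt0 : 0 < e by near: e; apply: nbhs_right_gt.
have e_lt : e < e0 by near: e; apply: nbhs_right_lt.
have ub : ubound (theta_quotients w B l e) (theta_value + eta).
  move=> _ [dB [da [db [x' [dx [hdB -> _ _ ->]]]]]].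
  by have [_ up _] := he e dB e_gt0 e_lt hdB; apply/up/pairing_le.
pose dB := worst_perturbation e.
have hdB i : spectral_norm (dB i) <= e * w i.
  by apply: worst_perturbation_norm; apply: ltW.
have [[z hz] _ low] := he e dB e_gt0 e_lt hdB.
set mu := perturbed_eigenvalue B l dB in hz low.
have mem : theta_quotients w B l e (chordal l mu / e).
  exists dB, (mu.1 - l.1), (mu.2 - l.2), x, (z - x) => /=.
  rewrite ![_ + (_ - _)]addrC !subrK -surjective_pairing.
  by split.
have lo : theta_value - eta <= sup (theta_quotients w B l e).
  apply: le_trans (low _) _; first exact/worst_perturbation_pairing/ltW.
  by apply: ub_le_sup => //; exists (theta_value + eta).
have hi : sup (theta_quotients w B l e) <= theta_value + eta.
  by apply: ge_sup => //; exists (chordal l mu / e).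
by rewrite ler_distlC lo hi.
Unshelve. all: by end_near.
Qed.

End StewartSun.

Theorem theorem3p2 (R : realType) (n k : nat) (B : 'I_k.+1 -> 'M[R[i]]_n)
    (alpha0 beta0 : R[i]) (omega : 'I_k.+1 -> R) (x y : 'cV[R[i]]_n) :
  regular B ->
  (alpha0, beta0) != (0, 0) ->
  simple_eigenvalue B (alpha0, beta0) ->
  (forall i, 0 <= omega i) ->
  \sum_(i < k.+1) cabs alpha0 ^+ i * cabs beta0 ^+ (k - i) * omega i != 0 ->
  right_eigenvector B (alpha0, beta0) x ->
  left_eigenvector B (alpha0, beta0) y ->
  kappa_h omega B (alpha0, beta0) x y =
    Num.sqrt (\sum_(i < k.+1) cabs alpha0 ^+ (2 * i) *
                cabs beta0 ^+ (2 * (k - i)) * omega i ^+ 2)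
    / (\sum_(i < k.+1) cabs alpha0 ^+ i * cabs beta0 ^+ (k - i) * omega i)
    * kappa_theta omega B (alpha0, beta0).
Proof.
move=> _ _ simple omega0 sum0 rx ly.
rewrite (kappa_thetaE simple omega0 rx ly) /theta_value /kappa_h.
have -> : (y ^t* *m ((alpha0, beta0).2^* *: evalmx (dalpha (hmxpoly B)) (alpha0, beta0)
    - (alpha0, beta0).1^* *: evalmx (dbeta (hmxpoly B)) (alpha0, beta0)) *m x) 0 0
    = pairing x y (mxcoef 1 (pencil B (alpha0, beta0)
        (normal_dir (alpha0, beta0)))).
  by rewrite pencil_coef1 /normal_dir /pairing scaleNr.
(* The weighted sum in [theta_value] cancels its inverse, being nonzero by [sum0]. *)
rewrite /= -!mulrA; congr (_ * _).
by rewrite mulKf.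
Qed.
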